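(* For every integer $n>1$, the critical exponent $p_n$ of the Riesz projection $P_n^+$ on $\mathbb{T}^n$ satisfies $$2+\frac{2}{2^n-1}\le p_n<4.$$
   Context: Let $\mathbb{T}=\{\zeta\in\mathbb{C}:|\zeta|=1\}$ and let $\sigma_n$ be Lebesgue measure on the $n$-torus $\mathbb{T}^n$, normalized so that $\sigma_n(\mathbb{T}^n)=1$; $L^p(\mathbb{T}^n)$ denotes the space of complex-valued functions with norm $\|f\|_p$ computed with respect to $\sigma_n$. For $f\in L^2(\mathbb{T}^n)$ with Fourier series $f(\zeta)=\sum_{\alpha\in\mathbb{Z}^n}\hat f(\alpha)\zeta^\alpha$ (multi-index notation), the Riesz projection is $P_n^+f(\zeta)=\sum_{\alpha\in\mathbb{Z}_+^n}\hat f(\alpha)\zeta^\alpha$, where $\mathbb{Z}_+=\{0,1,2,\dots\}$. For $2\le p<\infty$, $\|P_n^+\|_{\infty,p}$ denotes the norm of the operator $P_n^+:L^\infty(\mathbb{T}^n)\to L^p(\mathbb{T}^n)$, i.e. $\|P_n^+\|_{\infty,p}=\sup\{\|P_n^+f\|_p: f\in L^\infty(\mathbb{T}^n),\ \|f\|_\infty\le 1\}$. The critical exponent of $P_n^+$ is $p_n=\sup\{p\ge 2:\ \|P_n^+\|_{\infty,p}=1\}$. *)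

(* Defs.v *)
From HB Require Import structures.
From mathcomp Require Import all_boot all_order all_algebra finmap complex.
From mathcomp Require Import all_classical all_reals all_analysis.
From mathcomp Require Import measurable_realfun summability.
Import Order.TTheory GRing.Theory Num.Theory.
Import numFieldNormedType.Exports.
Import ComplexField.Normc.

Set Implicit Arguments.
Unset Strict Implicit.
Unset Printing Implicit Defensive.

Local Open Scope classical_set_scope.
Local Open Scope ring_scope.
Local Open Scope complex_scope.

Section circle.
Variable R : realType.

Definition circle := {z : R[i] | `|z| == 1}.

HB.instance Definition _ := Choice.on circle.

Fact circle1_subproof : `|1 : R[i]| == 1.
Proof. by rewrite normr1. Qed.

HB.instance Definition _ :=
  isPointed.Build circle (exist _ (1 : R[i]) circle1_subproof).

(* The Borel sigma-algebra of the circle is the trace of that of the plane. *)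
Definition circle_coords (z : circle) :
    measurableTypeR R * measurableTypeR R :=
  (complex.Re (val z), complex.Im (val z)).

Definition circle_measurable : set_system circle :=
  g_sigma_algebra_preimage circle_coords.

Let circle_measurable0 : circle_measurable set0.
Proof. exact: (@measurable0 _ (g_sigma_algebra_preimageType circle_coords)). Qed.

Let circle_measurableC A : circle_measurable A -> circle_measurable (~` A).
Proof. exact: (@measurableC _ (g_sigma_algebra_preimageType circle_coords)). Qed.

Let circle_measurable_bigcup (F : (set circle)^nat) :
  (forall k, circle_measurable (F k)) -> circle_measurable (\bigcup_k (F k)).
Proof.
exact: (@bigcupT_measurable _ (g_sigma_algebra_preimageType circle_coords)).
Qed.

HB.instance Definition _ := @isMeasurable.Build (preimage_display circle_coords)
  circle circle_measurable circle_measurable0 circle_measurableC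
  circle_measurable_bigcup.

Fact expi_subproof (t : R) : `|cos t +i* sin t| == 1.
Proof. by rewrite normc_def/= cos2Dsin2 sqrtr1. Qed.

Definition expi (t : measurableTypeR R) : circle :=
  exist _ (cos t +i* sin t) (expi_subproof t).

Fact measurable_expi : measurable_fun [set: measurableTypeR R] expi.
Proof.
move=> _ _ [B mB <-]; rewrite setTI.
have mcs : measurable_fun [set: measurableTypeR R] (circle_coords \o expi).
  apply/measurable_fun_pairP; split.
  - by apply: continuous_measurable_fun; exact: continuous_cos.
  - by apply: continuous_measurable_fun; exact: continuous_sin.
by have := mcs measurableT B mB; rewrite !setTI.
Qed.

HB.instance Definition _ := isMeasurableFun.Build _ _ _ _ expi measurable_expi.

Fact pi2_gt0 : (0 : R) < 2 * pi.
Proof. by rewrite mulr_gt0// pi_gt0. Qed.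

Definition circle_measure : probability circle R :=
  distribution (uniform_prob pi2_gt0) expi.

End circle.

Notation torus R n := (n.-tuple (circle R)).

Section torus_measure.
Variable R : realType.

Definition torus_cons n (z : circle R * torus R n) : torus R n.+1 :=
  [the n.+1.-tuple (circle R) of z.1 :: z.2].

Fact measurable_torus_cons n :
  measurable_fun [set: circle R * torus R n] (@torus_cons n).
Proof. exact: measurable_cons. Qed.

HB.instance Definition _ n :=
  isMeasurableFun.Build _ _ _ _ (@torus_cons n) (@measurable_torus_cons n).

(* The n-fold product of circle_measure, transported along
   T * T^m ~ T^(m+1); for n = 0 it is the point mass on the empty tuple. *)
Fixpoint torus_measure n : probability (torus R n) R :=
  if n is m.+1
  then distribution (circle_measure R \x torus_measure m)%E (@torus_cons m)
  else \d_([tuple] : torus R 0).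

End torus_measure.

Section riesz_projection.
Variables (R : realType) (n : nat).
Implicit Types (f g : torus R n -> R[i]) (a : {ffun 'I_n -> int}).

Definition measurable_complex f : Prop :=
  measurable_fun [set: torus R n] (fun z => complex.Re (f z)) /\
  measurable_fun [set: torus R n] (fun z => complex.Im (f z)).

Definition torus_norm (p : \bar R) f : \bar R :=
  'N[torus_measure R n]_p[EFin \o (fun z => normc (f z))].

Definition torus_integral f : R[i] :=
  (\int[torus_measure R n]_z complex.Re (f z)) +i*
  (\int[torus_measure R n]_z complex.Im (f z)).

Definition monomial a (z : torus R n) : R[i] :=
  \prod_(i < n) val (tnth z i) ^ a i.

Definition fourier_coef f a : R[i] :=
  torus_integral (fun z => f z * (monomial a z)^*).

Definition riesz_partial_sum f (A : {fset {ffun 'I_n -> int}})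
    (z : torus R n) : R[i] :=
  \sum_(a <- A | [forall i, 0 <= a i]) fourier_coef f a * monomial a z.

(* g represents the Riesz projection of f: the sum over the multi-indices in
   Z_+^n is the unconditional L^2 sum, that is, the L^2 limit along the finite
   subsets of Z^n ordered by inclusion.  It determines g up to a null set. *)
Definition is_riesz_projection f g : Prop :=
  measurable_complex g /\
  torus_norm 2%:E (fun z => g z - riesz_partial_sum f A z)
    @[A --> totally] --> 0%E.

(* The norm from L^oo to L^p, with values in [0, +oo]. *)
Definition riesz_norm (p : R) : \bar R :=
  ereal_sup [set y | exists f g,
    [/\ measurable_complex f, (torus_norm +oo f <= 1)%E,
        is_riesz_projection f g & y = torus_norm p%:E g]].

End riesz_projection.

Definition critical_exponent (R : realType) (n : nat) : \bar R :=
  ereal_sup [set p%:E | p in [set p : R | 2 <= p /\ riesz_norm n p = 1%E]].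

(* Main.v *)
(**
Lower bound. Let [P] be the Riesz projection in one variable and write
[f = g + conj h] with [g = P f]. If [|f| = 1], then
[|g|^2 + |h|^2 + 2 Re (g h) = 1], and squaring and integrating gives
[E |g|^4 + E |h|^4 = 1], because [g h] and [(g h)^2] have mean zero. Hence [P] is a
contraction from [L^oo] to [L^4]. It is also a contraction on [L^2], and the
Riesz-Thorin theorem makes it a contraction from [L^q] to [L^(4 q / (q + 2))] for
[q >= 2]. Starting from [L^oo] and composing the projections in the [n] variables
ends in [L^p] with [1 / p = (1 - 2^-n) / 2]. To stay with finite sums, every
projection is preceded by a Fejer mean, which is removed in the end by a limit in
[L^2]. The interpolation rests on a three lines theorem for exponential sums; it
follows from the near-invariance of such sums under averaging over the four points
[z + h], [z - h], [z + i h], [z - i h].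

Upper bound. Put [x = Re (z1 * conj z2)] and let [t] be the Taylor polynomial of
degree 4 of [exp (i x)], which satisfies [|t x| <= 1]. The projection of
[f = z1 z2 t(x)] is [g = z1 z2 (49 / 64 + i (7 / 8) x)], and [E |g|^4 > 1.01]; since
[g] is bounded, [E |g|^p > 1] already for some [p < 4].
*)

Require Import Defs.
From HB Require Import structures.
From mathcomp Require Import all_boot all_order all_algebra finmap complex.
From mathcomp Require Import all_classical all_reals all_analysis.
From mathcomp Require Import measurable_realfun summability ess_sup_inf ring lra.
Import Order.TTheory GRing.Theory Num.Theory.
Import numFieldNormedType.Exports.
Import ComplexField.Normc.

Set Implicit Arguments.
Unset Strict Implicit.
Unset Printing Implicit Defensive.

Local Open Scope classical_set_scope.
Local Open Scope ring_scope.
Local Open Scope complex_scope.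
(* In [ring_scope] this notation would otherwise denote [Num.conj]. *)
Local Notation "z ^*" := (conjc z) : ring_scope.

(** * Complex-valued bounded functions and their expectations *)

Section complex_norm.
Variable R : realType.
Implicit Types (x y z : R[i]) (a b : R).

(** Each of the [n] projections acts on functions of all variables. It is therefore treated as a
    half-space projection on the whole torus: [dg] is an additive degree on the group of
    frequencies, and the [L^4] argument rests on the fact that a frequency of degree [>= 0] and one
    of degree [> 0] add up to one of positive degree. Interpolation at [theta] turns the gap
    [1/2 - 1/q = theta/2] into [1/2 - 1/r = theta/4]. So every projection halves the gap, which is
    [1/2] at [L^oo]; this is the origin of [2^-n]. Only [theta = 2^-k] occurs, hence a three lines
    bound at rational abscissae is enough. Duality is replaced by pairing the output with itself. A
    Riesz projection [g] is known only as an [L^2] limit, so its moments are first bounded for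
    [min (|g|, M)]. For the upper bound, in powers of [v = z1 * conj z2] the projection of [z1 z2 t]
    is the symmetric cut-off to [v^-1, 1, v], which no half-space projection produces. The
    polynomial [t] imitates the unimodular [exp (i x)] while keeping all coefficients rational. *)

Lemma cReD x y : complex.Re (x + y) = complex.Re x + complex.Re y.
Proof. by case: x y => [? ?] [? ?]. Qed.

Lemma cImD x y : complex.Im (x + y) = complex.Im x + complex.Im y.
Proof. by case: x y => [? ?] [? ?]. Qed.

Lemma cReN x : complex.Re (- x) = - complex.Re x.
Proof. by case: x. Qed.

Lemma cImN x : complex.Im (- x) = - complex.Im x.
Proof. by case: x. Qed.

Lemma cReM x y :
  complex.Re (x * y) = complex.Re x * complex.Re y - complex.Im x * complex.Im y.
Proof. by case: x y => [? ?] [? ?]. Qed.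

Lemma cImM x y :
  complex.Im (x * y) = complex.Re x * complex.Im y + complex.Im x * complex.Re y.
Proof. by case: x y => [? ?] [? ?]. Qed.

Lemma cReJ x : complex.Re x^* = complex.Re x.
Proof. by case: x. Qed.

Lemma cImJ x : complex.Im x^* = - complex.Im x.
Proof. by case: x. Qed.

Definition cReImE := (cReD, cImD, cReN, cImN, cReM, cImM, cReJ, cImJ).

Lemma normc_ge0 z : 0 <= normc z.
Proof. by case: z => a b; rewrite sqrtr_ge0. Qed.

Lemma sqr_normc2 z : normc z ^+ 2 = complex.Re z ^+ 2 + complex.Im z ^+ 2.
Proof. by case: z => a b /=; rewrite sqr_sqrtr// addr_ge0 ?sqr_ge0. Qed.

Lemma normc_conj z : normc z^* = normc z.
Proof. by case: z => a b /=; rewrite sqrrN. Qed.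

Lemma normcX z n : normc (z ^+ n) = normc z ^+ n.
Proof.
elim: n => [|n IH]; first by rewrite !expr0 normc1.
by rewrite !exprS normcM IH.
Qed.

Lemma normc_real a : normc (a%:C) = `|a|.
Proof. by rewrite /= expr0n/= addr0 sqrtr_sqr. Qed.

Lemma ler_Re_normc z : complex.Re z <= normc z.
Proof.
apply: le_trans (ler_norm _) _; rewrite -ler_sqr ?nnegrE ?normc_ge0//.
by rewrite sqr_normc2 real_normK ?num_real// lerDl sqr_ge0.
Qed.

Lemma ler_normRe_normc z : `|complex.Re z| <= normc z.
Proof.
rewrite -ler_sqr ?nnegrE ?normc_ge0//.
by rewrite sqr_normc2 real_normK ?num_real// lerDl sqr_ge0.
Qed.

Lemma ler_normIm_normc z : `|complex.Im z| <= normc z.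
Proof.
rewrite -ler_sqr ?nnegrE ?normc_ge0//.
by rewrite sqr_normc2 real_normK ?num_real// lerDr sqr_ge0.
Qed.

Lemma ler_normc_sum (I : Type) (s : seq I) (F : I -> R[i]) :
  normc (\sum_(i <- s) F i) <= \sum_(i <- s) normc (F i).
Proof.
elim/big_rec2: _ => [|i x y _ le_yx]; first by rewrite normc0.
by apply: le_trans (le_normcD _ _) _; rewrite lerD2l.
Qed.

Lemma complexP x y : complex.Re x = complex.Re y -> complex.Im x = complex.Im y ->
  x = y.
Proof. by case: x y => [? ?] [? ?] /= -> ->. Qed.

Lemma sqr_normcE z : (normc z ^+ 2)%:C = z * z^*.
Proof.
by rewrite sqr_normc2; apply: complexP; rewrite !cReImE /=; ring.
Qed.

Lemma mulcJ_of_normc1 z : normc z = 1 -> z * z^* = 1.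
Proof. by move=> z1; rewrite -sqr_normcE z1 expr1n. Qed.

Lemma exists_phase z : exists u, normc u = 1 /\ u * z = (normc z)%:C.
Proof.
have [->|z0] := eqVneq z 0.
  by exists 1; rewrite normc1 mul1r normc0.
have nz0 : normc z != 0.
  by apply: contra z0 => /eqP /eq0_normc ->.
exists ((normc z)^-1%:C * z^*); split.
  by rewrite normcM normc_real normc_conj ger0_norm ?invr_ge0 ?normc_ge0// mulVf.
rewrite -mulrA (mulrC z^*) -sqr_normcE -rmorphM/=.
by rewrite expr2 mulKf.
Qed.

End complex_norm.

Section bounded_functions.
Context d (T : measurableType d) (R : realType).
Implicit Types (f g : T -> R).

(** The bound holds at every point rather than almost everywhere, which keeps the calculus of
    expectations free of null sets. The essential bound of the theorem is converted once, in
    [truncate_le1]. *)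
Definition bfun f := measurable_fun setT f /\ exists M, forall x, `|f x| <= M.

Lemma bfun_cst a : bfun (fun=> a).
Proof. by split; [exact: measurable_cst|exists `|a|]. Qed.

Lemma bfunD f g : bfun f -> bfun g -> bfun (fun x => f x + g x).
Proof.
move=> [mf [M fM]] [mg [N gN]]; split; first exact: measurable_funD.
by exists (M + N) => x; apply: le_trans (ler_normD _ _) _; exact: lerD.
Qed.

Lemma bfunM f g : bfun f -> bfun g -> bfun (fun x => f x * g x).
Proof.
move=> [mf [M fM]] [mg [N gN]]; split; first exact: measurable_funM.
by exists (M * N) => x; rewrite normrM ler_pM.
Qed.

Lemma bfunN f : bfun f -> bfun (fun x => - f x).
Proof.
move=> [mf [M fM]]; split; first exact: measurableT_comp.
by exists M => x; rewrite normrN.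
Qed.

Lemma bfunB f g : bfun f -> bfun g -> bfun (fun x => f x - g x).
Proof. by move=> bf bg; apply: bfunD => //; exact: bfunN. Qed.

Lemma bfunX f n : bfun f -> bfun (fun x => f x ^+ n).
Proof.
move=> bf; elim: n => [|n IH]; first exact: bfun_cst.
by under eq_fun do rewrite exprS; exact: bfunM.
Qed.

Lemma bfun_sum (I : Type) (s : seq I) (F : I -> T -> R) :
  (forall i, bfun (F i)) -> bfun (fun x => \sum_(i <- s) F i x).
Proof.
move=> bF; elim: s => [|i s IH].
  by under eq_fun do rewrite big_nil; exact: bfun_cst.
by under eq_fun do rewrite big_cons; exact: bfunD.
Qed.

Lemma bfun_comp (h : R -> R) f : measurable_fun setT h ->
  (forall M, exists N, forall y, `|y| <= M -> `|h y| <= N) ->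
  bfun f -> bfun (h \o f).
Proof.
move=> mh bh [mf [M fM]]; split; first exact: measurableT_comp.
by have [N hN] := bh M; exists N => x; exact: hN.
Qed.

Lemma bfun_expR f : bfun f -> bfun (fun x => expR (f x)).
Proof.
apply: bfun_comp => // M; exists (expR M) => y yM.
by rewrite ger0_norm ?expR_ge0// ler_expR (le_trans (ler_norm y)).
Qed.

Lemma bfun_cos f : bfun f -> bfun (fun x => cos (f x)).
Proof.
apply: bfun_comp.
  by apply: continuous_measurable_fun; exact: continuous_cos.
by move=> M; exists 1 => y _; rewrite ler_norml cos_geN1 cos_le1.
Qed.

Lemma bfun_sin f : bfun f -> bfun (fun x => sin (f x)).
Proof.
apply: bfun_comp.
  by apply: continuous_measurable_fun; exact: continuous_sin.
by move=> M; exists 1 => y _; rewrite ler_norml sin_geN1 sin_le1.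
Qed.

Lemma bfun_powR f a : 0 <= a -> (forall x, 0 <= f x) -> bfun f ->
  bfun (fun x => f x `^ a).
Proof.
move=> a0 f0 [mf [M fM]]; split.
  exact: (measurableT_comp (measurable_powR a)).
exists (M `^ a) => x; rewrite ger0_norm ?powR_ge0//.
have fxM : f x <= M by rewrite (le_trans (ler_norm _)).
by rewrite ge0_ler_powR// nnegrE// (le_trans _ fxM).
Qed.

Lemma bfun_max f g : bfun f -> bfun g -> bfun (fun x => Num.max (f x) (g x)).
Proof.
move=> [mf [M fM]] [mg [N gN]]; split; first exact: measurable_maxr.
exists (M + N) => x; have M0 := le_trans (normr_ge0 _) (fM x).
have N0 := le_trans (normr_ge0 _) (gN x); rewrite /Num.max.
by case: ifP => _; [rewrite (le_trans (gN x)) ?lerDr|rewrite (le_trans (fM x)) ?lerDl].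
Qed.

End bounded_functions.

Section bounded_complex_functions.
Context d (T : measurableType d) (R : realType).
Implicit Types (f g : T -> R[i]).

Definition bcfun f :=
  bfun (fun x => complex.Re (f x)) /\ bfun (fun x => complex.Im (f x)).

Lemma bcfun_cst a : bcfun (fun=> a).
Proof. by split; exact: bfun_cst. Qed.

Lemma bcfunD f g : bcfun f -> bcfun g -> bcfun (fun x => f x + g x).
Proof.
by move=> [rf mf] [rg mg]; split; under eq_fun do rewrite cReImE; exact: bfunD.
Qed.

Lemma bcfunM f g : bcfun f -> bcfun g -> bcfun (fun x => f x * g x).
Proof.
move=> [rf mf] [rg mg]; split; under eq_fun do rewrite cReImE.
  by apply: bfunB; exact: bfunM.
by apply: bfunD; exact: bfunM.
Qed.

Lemma bcfunN f : bcfun f -> bcfun (fun x => - f x).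
Proof.
by move=> [rf mf]; split; under eq_fun do rewrite cReImE; exact: bfunN.
Qed.

Lemma bcfunB f g : bcfun f -> bcfun g -> bcfun (fun x => f x - g x).
Proof. by move=> bf bg; apply: bcfunD => //; exact: bcfunN. Qed.

Lemma bcfunJ f : bcfun f -> bcfun (fun x => (f x)^*).
Proof.
move=> [rf mf]; split; first by under eq_fun do rewrite cReJ.
by under eq_fun do rewrite cImJ; exact: bfunN.
Qed.

Lemma bcfunX f n : bcfun f -> bcfun (fun x => f x ^+ n).
Proof.
move=> bf; elim: n => [|n IH]; first exact: bcfun_cst.
by under eq_fun do rewrite exprS; exact: bcfunM.
Qed.

Lemma bcfun_sum (I : Type) (s : seq I) (F : I -> T -> R[i]) :
  (forall i, bcfun (F i)) -> bcfun (fun x => \sum_(i <- s) F i x).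
Proof.
move=> bF; elim: s => [|i s IH].
  by under eq_fun do rewrite big_nil; exact: bcfun_cst.
by under eq_fun do rewrite big_cons; exact: bcfunD.
Qed.

Lemma bcfun_real (f : T -> R) : bfun f -> bcfun (fun x => (f x)%:C).
Proof. by move=> bf; split => //=; exact: bfun_cst. Qed.

Lemma bfun_normc f : bcfun f -> bfun (fun x => normc (f x)).
Proof.
move=> [rf mf].
have := bfunD (bfunX 2 rf) (bfunX 2 mf).
under eq_fun do rewrite -sqr_normc2.
move=> b2; have [m2 [M fM]] := b2.
have -> : (fun x => normc (f x)) = Num.sqrt \o (fun x => normc (f x) ^+ 2).
  by apply/funext => x /=; rewrite sqrtr_sqr ger0_norm ?normc_ge0.
apply: bfun_comp b2.
  by apply: continuous_measurable_fun; exact: sqrt_continuous.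
move=> N; exists (Num.sqrt N) => y yN.
rewrite ger0_norm ?sqrtr_ge0// ler_wsqrtr//.
by rewrite (le_trans (ler_norm _)).
Qed.

Lemma bcfunE f : measurable_fun setT (fun x => complex.Re (f x)) ->
  measurable_fun setT (fun x => complex.Im (f x)) ->
  (exists M, forall x, normc (f x) <= M) -> bcfun f.
Proof.
move=> mr mi [M fM]; split; split=> //; exists M => x.
  exact: le_trans (ler_normRe_normc _) _.
exact: le_trans (ler_normIm_normc _) _.
Qed.

End bounded_complex_functions.

Section expectation.
Context d (T : measurableType d) (R : realType) (P : probability T R).
Implicit Types (f g : T -> R).

Lemma bfun_integrable f : bfun f -> P.-integrable setT (EFin \o f).
Proof.
move=> [mf [M fM]]; apply: measurable_bounded_integrable => //.
  by apply: le_lt_trans (probability_le1 P measurableT) _; rewrite ltry.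
exists M; split; first by rewrite num_real.
by move=> y My x _; apply: le_trans (fM x) (ltW My).
Qed.

(** A real number by default: an infinite integral would become 0. Expectations are therefore taken
    of bounded functions, and unbounded ones are truncated before they enter [Er]. *)
Definition Er f : R := \int[P]_x f x.

Lemma Er_cst a : Er (fun=> a) = a.
Proof. by rewrite /Er Rintegral_cst//= probability_setT mulr1. Qed.

Lemma ErD f g : bfun f -> bfun g -> Er (fun x => f x + g x) = Er f + Er g.
Proof. by move=> bf bg; rewrite /Er RintegralD//; exact: bfun_integrable. Qed.

Lemma ErB f g : bfun f -> bfun g -> Er (fun x => f x - g x) = Er f - Er g.
Proof. by move=> bf bg; rewrite /Er RintegralB//; exact: bfun_integrable. Qed.

Lemma ErZ a f : bfun f -> Er (fun x => a * f x) = a * Er f.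
Proof. by move=> bf; rewrite /Er RintegralZl//; exact: bfun_integrable. Qed.

Lemma ErN f : bfun f -> Er (fun x => - f x) = - Er f.
Proof. by move=> bf; under eq_fun do rewrite -mulN1r; rewrite ErZ// mulN1r. Qed.

Lemma Er_le f g : bfun f -> bfun g -> (forall x, f x <= g x) -> Er f <= Er g.
Proof. by move=> bf bg fg; apply: le_Rintegral => //; exact: bfun_integrable. Qed.

Lemma Er_ge0 f : (forall x, 0 <= f x) -> 0 <= Er f.
Proof. by move=> f0; exact: Rintegral_ge0. Qed.

Lemma EFin_Er f : bfun f -> (Er f)%:E = (\int[P]_x (f x)%:E)%E.
Proof.
by move=> bf; rewrite /Er /Rintegral fineK//; exact: integrable_fin_num (bfun_integrable bf).
Qed.

End expectation.

Section complex_expectation.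
Context d (T : measurableType d) (R : realType) (P : probability T R).
Implicit Types (f g : T -> R[i]).

Definition Ec f : R[i] :=
  Er P (fun x => complex.Re (f x)) +i* Er P (fun x => complex.Im (f x)).

Lemma Ec_cst a : Ec (fun=> a) = a.
Proof. by apply: complexP; rewrite /= Er_cst. Qed.

Lemma EcD f g : bcfun f -> bcfun g -> Ec (fun x => f x + g x) = Ec f + Ec g.
Proof.
move=> [rf mf] [rg mg]; apply: complexP; rewrite cReImE/= -ErD//;
  by under eq_fun do rewrite cReImE.
Qed.

Lemma EcN f : bcfun f -> Ec (fun x => - f x) = - Ec f.
Proof.
move=> [rf mf]; apply: complexP; rewrite cReImE/= -ErN//;
  by under eq_fun do rewrite cReImE.
Qed.

Lemma EcB f g : bcfun f -> bcfun g -> Ec (fun x => f x - g x) = Ec f - Ec g.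
Proof. by move=> bf bg; rewrite EcD ?EcN//; exact: bcfunN. Qed.

Lemma EcJ f : bcfun f -> Ec (fun x => (f x)^*) = (Ec f)^*.
Proof.
move=> [rf mf]; apply: complexP; rewrite cReImE/= -?ErN//;
  by under eq_fun do rewrite cReImE.
Qed.

Lemma EcZ a f : bcfun f -> Ec (fun x => a * f x) = a * Ec f.
Proof.
move=> [rf mf]; apply: complexP; rewrite cReImE/= -!ErZ// -?ErB -?ErD;
  do ?[apply: bfunM => //; exact: bfun_cst];
  by under eq_fun do rewrite cReImE.
Qed.

Lemma Ec_sum (I : Type) (s : seq I) (F : I -> T -> R[i]) :
  (forall i, bcfun (F i)) ->
  Ec (fun x => \sum_(i <- s) F i x) = \sum_(i <- s) Ec (F i).
Proof.
move=> bF; elim: s => [|i s IH].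
  by rewrite big_nil; under eq_fun do rewrite big_nil; exact: Ec_cst.
rewrite big_cons; under eq_fun do rewrite big_cons.
by rewrite EcD ?IH//; exact: bcfun_sum.
Qed.

Lemma Ec_real (f : T -> R) : Ec (fun x => (f x)%:C) = (Er P f)%:C.
Proof. by apply: complexP => //=; rewrite Er_cst. Qed.

Lemma Re_Ec f : complex.Re (Ec f) = Er P (fun x => complex.Re (f x)).
Proof. by []. Qed.

Lemma Ec_sqr_normc f : Ec (fun x => f x * (f x)^*) = (Er P (fun x => normc (f x) ^+ 2))%:C.
Proof. by rewrite -Ec_real; under eq_fun do rewrite -sqr_normcE. Qed.

Lemma normc_Ec_le f : bcfun f -> normc (Ec f) <= Er P (fun x => normc (f x)).
Proof.
move=> bf; have [u [u1 uE]] := exists_phase (Ec f).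
have : complex.Re (u * Ec f) = normc (Ec f) by rewrite uE.
move=> <-; rewrite -EcZ// Re_Ec; apply: Er_le.
- by have [] := bcfunM (bcfun_cst _ u) bf.
- exact: bfun_normc.
- by move=> x; rewrite (le_trans (ler_Re_normc _))// normcM u1 mul1r.
Qed.

End complex_expectation.

Section product_expectation.
Context d1 d2 (T1 : measurableType d1) (T2 : measurableType d2) (R : realType).

Lemma bfun_fst (f : T1 -> R) : bfun f -> bfun (fun z : T1 * T2 => f z.1).
Proof.
move=> [mf [M fM]]; split; last by exists M.
exact: (measurableT_comp mf measurable_fst).
Qed.

Lemma bfun_snd (f : T2 -> R) : bfun f -> bfun (fun z : T1 * T2 => f z.2).
Proof.
move=> [mf [M fM]]; split; last by exists M.
exact: (measurableT_comp mf measurable_snd).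
Qed.

Lemma bcfun_fst (f : T1 -> R[i]) : bcfun f -> bcfun (fun z : T1 * T2 => f z.1).
Proof. by move=> [rf mf]; split; [exact: bfun_fst rf|exact: bfun_fst mf]. Qed.

Lemma bcfun_snd (f : T2 -> R[i]) : bcfun f -> bcfun (fun z : T1 * T2 => f z.2).
Proof. by move=> [rf mf]; split; [exact: bfun_snd rf|exact: bfun_snd mf]. Qed.

Variables (P1 : probability T1 R) (P2 : probability T2 R).

Lemma Er_prod (f : T1 -> R) (g : T2 -> R) : bfun f -> bfun g ->
  Er (P1 \x P2)%E (fun z => f z.1 * g z.2) = Er P1 f * Er P2 g.
Proof.
move=> bf bg.
have bfg : bfun (fun z : T1 * T2 => f z.1 * g z.2).
  by apply: bfunM; [exact: bfun_fst|exact: bfun_snd].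
apply: EFin_inj; rewrite EFin_Er// -integral12_prod_meas1; last first.
  exact: (bfun_integrable (P1 \x P2)%E bfg).
rewrite EFinM EFin_Er// -integralZr//; last exact: bfun_integrable.
apply: eq_integral => x _.
rewrite /fubini_F/= EFin_Er// -integralZl//; last exact: bfun_integrable.
Qed.

Lemma Ec_prod (f : T1 -> R[i]) (g : T2 -> R[i]) : bcfun f -> bcfun g ->
  Ec (P1 \x P2)%E (fun z => f z.1 * g z.2) = Ec P1 f * Ec P2 g.
Proof.
move=> [rf mf] [rg mg].
have b1 (f1 : T1 -> R) (g1 : T2 -> R) : bfun f1 -> bfun g1 ->
    bfun (fun z : T1 * T2 => f1 z.1 * g1 z.2).
  by move=> *; apply: bfunM; [exact: bfun_fst|exact: bfun_snd].
apply: complexP; rewrite cReImE/= -!Er_prod// -?ErB -?ErD;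
  do 1?[exact: (b1 _ _ rf rg)|exact: (b1 _ _ mf mg)|exact: (b1 _ _ rf mg)
       |exact: (b1 _ _ mf rg)].
  by congr Er; apply/funext => z; rewrite cReM.
by congr Er; apply/funext => z; rewrite cImM.
Qed.

End product_expectation.

Section pushforward_expectation.
Context d1 d2 (T1 : measurableType d1) (T2 : measurableType d2) (R : realType).
Variables (P : probability T1 R) (X : {mfun T1 >-> T2}).

Lemma bfun_mfun (f : T2 -> R) : bfun f -> bfun (fun x => f (X x)).
Proof.
move=> [mf [M fM]]; split; last by exists M.
exact: (measurableT_comp mf (measurable_funPT X)).
Qed.

Lemma Er_distribution (f : T2 -> R) : bfun f ->
  Er (distribution P X) f = Er P (fun x => f (X x)).
Proof.
move=> bf; apply: EFin_inj; rewrite !EFin_Er//; last exact: bfun_mfun.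
rewrite integral_distribution//; first by apply/measurable_EFinP; case: bf.
exact: bfun_integrable (bfun_mfun bf).
Qed.

Lemma Ec_distribution (f : T2 -> R[i]) : bcfun f ->
  Ec (distribution P X) f = Ec P (fun x => f (X x)).
Proof. by move=> [rf mf]; apply: complexP; rewrite /= Er_distribution. Qed.

End pushforward_expectation.

(** * A discrete three lines theorem *)

Section elementary_functions.
Variable R : realType.
Implicit Types (a s : R).

Lemma mean_value_from0 (f df : R -> R) a : (forall x : R, is_derive x 1 f (df x)) -> 0 <= a ->
  exists2 c, 0 <= c <= a & f a - f 0 = df c * a.
Proof.
move=> fdf a0.
have [|c] := @MVT_segment R f df 0 a a0 (fun x _ => fdf x).
  apply: continuous_subspaceT => x.
  by apply/differentiable_continuous/derivable1_diffP; exact: (@ex_derive _ _ _ _ _ _ _ (fdf x)).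
by rewrite in_itv/= subr0 => c0a ->; exists c.
Qed.

Lemma ler_sin a : 0 <= a -> `|sin a| <= a.
Proof.
move=> a0; have [c _] := mean_value_from0 (@is_derive_sin R) a0.
rewrite sin0 subr0 => ->.
by rewrite normrM (ger0_norm a0) ler_piMl// ler_norml cos_geN1 cos_le1.
Qed.

Lemma ler_subr_sin a : 0 <= a -> `|a - sin a| <= a ^+ 3.
Proof.
move=> a0.
have [c /andP[c0 ca]] := @mean_value_from0 (fun x => x - sin x) (fun x => 1 - cos x) a _ a0.
rewrite sin0 !subr0 => ->.
have -> : 1 - cos c = 2 * sin (c / 2) ^+ 2.
  have cE : c = (c / 2) *+ 2 by rewrite -mulr_natr divfK.
  rewrite [in LHS]cE cos_mulr2n mulr2n.
  have -> : cos (c / 2) ^+ 2 = 1 - sin (c / 2) ^+ 2 by rewrite cos2sin2.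
  by ring.
have s2 : `|sin (c / 2)| <= a / 2.
  by rewrite (le_trans (ler_sin _)) ?divr_ge0// ler_pM2r ?invr_gt0.
have : sin (c / 2) ^+ 2 <= (a / 2) ^+ 2.
  by rewrite -[leLHS](real_normK (num_real _)) ler_sqr ?nnegrE ?divr_ge0.
rewrite normrM (ger0_norm a0) (@ger0_norm _ (2 * _)); last by rewrite pmulr_rge0// sqr_ge0.
move=> h.
rewrite (exprSr a 2) ler_wpM2r//.
rewrite expr_div_n in h; have := sqr_ge0 a; lra.
Qed.

Lemma ler_expR_subr1B a : `|a| <= 2^-1 -> 0 <= expR a - 1 - a <= 2 * a ^+ 2.
Proof.
rewrite ler_norml => /andP[am ap].
have h1 := expR_ge1Dx a; have h2 := expR_ge1Dx (- a).
have h3 := expRxMexpNx_1 a; have e0 := expR_gt0 a.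
rewrite subr_ge0 lerBrDl h1/=.
have : expR a * (1 - a) <= 1 by rewrite -[leRHS]h3 ler_pM2l.
move=> h; have a2 := sqr_ge0 a.
have : (expR a - 1 - a) * (1 - a) <= a ^+ 2 by nra.
move: h1; rewrite -subr_ge0 opprD addrA; move: (expR a - 1 - a) => z; nra.
Qed.

(** The true order is [s ^ 4], but a cubic bound suffices: convexity along a grid of mesh [h] costs
    a factor [h ^- 2], and [h ^ 3 / h ^ 2] still tends to 0. *)
Lemma cosh_cos_bound s : `|s| <= 1 ->
  `|expR s + expR (- s) + 2 * cos s - 4| <= 2 * `|s| ^+ 3.
Proof.
wlog s0 : s / 0 <= s => [hw|].
  have [/hw//|s0] := leP 0 s; rewrite -normrN => s1.
  by have := hw (- s); rewrite oppr_ge0 (ltW s0) cosN opprK addrAC (addrC (expR s)) addrAC; apply.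
rewrite ger0_norm// => s1.
set a := s / 2; have a0 : 0 <= a by rewrite divr_ge0.
have sE : s = a *+ 2 by rewrite /a -mulr_natr divfK.
set S := expR a - expR (- a).
(* A difference of squares: [exp s + exp (- s) - 2 = S ^ 2] and [2 - 2 cos s = (2 sin a) ^ 2]. The
   factors are at most [3 a ^ 2] and [5 a], and [15 a ^ 3 <= 2 s ^ 3] since [s = 2 a]. *)
have -> : expR s + expR (- s) + 2 * cos s - 4 =
    (S - 2 * sin a) * (S + 2 * sin a).
  rewrite /S sE cos_mulr2n -mulNrn !mulr2n !expRD.
  have := expRxMexpNx_1 a; have := cos2Dsin2 a.
  set E := expR a; set F := expR (- a); set k := cos a; set t := sin a => h1 h2.
  have -> : k ^+ 2 = 1 - t ^+ 2 by rewrite -h1; ring.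
  rewrite (_ : E * E + F * F = (E - F) ^+ 2 + 2 * (E * F)); last by ring.
  by rewrite h2; ring.
have ah : `|a| <= 2^-1 by rewrite ger0_norm// /a; lra.
have /andP[p1 p2] := ler_expR_subr1B ah.
have : `|- a| <= 2^-1 by rewrite normrN.
move=> /ler_expR_subr1B/andP[q1 q2].
have := ler_sin a0; have := ler_subr_sin a0.
rewrite !ler_norml => /andP[r1 r2] /andP[t1 t2].
have a12 : a <= 2^-1 by rewrite /a; lra.
have a32 : a ^+ 3 <= 2^-1 * a ^+ 2 by rewrite exprS ler_wpM2r ?sqr_ge0.
have a2a : a ^+ 2 <= 2^-1 * a by rewrite expr2 ler_wpM2r.
have b1 : `|S - 2 * sin a| <= 3 * a ^+ 2.
  by rewrite ler_norml /S; apply/andP; split; lra.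
have b2 : `|S + 2 * sin a| <= 5 * a.
  by rewrite ler_norml /S; apply/andP; split; lra.
rewrite -ler_norml normrM; apply: le_trans (ler_pM _ _ b1 b2) _ => //.
rewrite sE -mulr_natr !exprSr expr0 !mul1r.
have : 0 <= a * a * a by rewrite !mulr_ge0.
nra.
Qed.

Definition cis a : R[i] := cos a +i* sin a.

Lemma normc_cis a : normc (cis a) = 1.
Proof. by rewrite /= cos2Dsin2 sqrtr1. Qed.

Lemma cisD a b : cis (a + b) = cis a * cis b.
Proof. by apply: complexP; rewrite cReImE/= ?cosD ?sinD//; ring. Qed.

Lemma cis0 : cis 0 = 1.
Proof. by rewrite /cis cos0 sin0. Qed.

End elementary_functions.

Section discrete_three_lines.
Variable R : realType.

(* The first index where [b] exceeds [K] is followed by a strict increase. *)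
Lemma convex_seq_le (b : nat -> R) K N : b 0%N <= K -> b N <= K ->
  (forall i, (i.+1 < N)%N -> 2 * b i.+1 <= b i.+2 + b i) ->
  forall i, (i <= N)%N -> b i <= K.
Proof.
move=> b0 bN cvx i iN; rewrite leNgt; apply/negP => Kbi.
have exK : exists j, (j <= N)%N && (K < b j) by exists i; rewrite iN.
case: (ex_minnP exK) => -[|k] /andP[kN Kbk] kmin.
  by move: Kbk; rewrite ltNge b0.
have bk : b k <= K.
  rewrite leNgt; apply/negP => Kbk'.
  by have := kmin k; rewrite (ltnW kN) Kbk' ltnn => /(_ isT).
have incr m : (k + m < N)%N -> b (k + m)%N < b (k + m).+1.
  elim: m => [|m IH] kmN; first by rewrite addn0 (le_lt_trans bk).
  rewrite addnS in kmN *.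
  have := IH (ltnW kmN); have := cvx _ kmN; lra.
have Kb m : (k.+1 + m <= N)%N -> K < b (k.+1 + m)%N.
  elim: m => [|m IH] kmN; first by rewrite addn0.
  rewrite addnS in kmN *; apply: lt_trans (IH (ltnW kmN)) _.
  by rewrite addSnnS; apply: incr; rewrite -addSnnS.
by have := Kb (N - k.+1)%N; rewrite subnKC// ltNge bN => /(_ (leqnn _)).
Qed.

(* The supremum [m x] of [Phi x] is nearly convex along a grid of mesh [h]: adding
   [C / 2 * h ^+ 3 * i ^+ 2] makes it convex, and this term is at most [C * h]. *)
Lemma discrete_three_lines (Phi : R -> R -> R) (C0 C h0 : R) : 0 <= C -> 0 < h0 ->
  (forall x y, 0 <= x <= 1 -> Phi x y <= C0) ->
  (forall h x y, 0 < h <= h0 -> 0 <= x - h -> x + h <= 1 ->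
    4 * Phi x y <= Phi (x + h) y + Phi (x - h) y + Phi x (y + h) + Phi x (y - h)
                   + C * h ^+ 3) ->
  (forall y, Phi 0 y <= 1) -> (forall y, Phi 1 y <= 1) ->
  forall (j J : nat) y, (0 < J)%N -> (j <= J)%N -> Phi (j%:R / J%:R) y <= 1.
Proof.
move=> C_ge0 h00 PhiC four Phi0 Phi1 j J y0 J0 jJ.
pose m x := sup (range (Phi x)).
have mP x y : 0 <= x <= 1 -> Phi x y <= m x.
  move=> x01; apply: ub_le_sup; last by exists y.
  by exists C0 => _ [z _ <-]; exact: PhiC.
have mle x K : (forall y, Phi x y <= K) -> m x <= K.
  move=> xK; apply: ge_sup; first by exists (Phi x 0), 0.
  by move=> _ [z _ <-].
(* With mesh [1 / (J k)] the abscissa [j / J] is a grid point for every [k], so the error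
   [C / (J k)] can be sent to 0 at a fixed point. *)
suff main (k : nat) : (0 < k)%N -> (J * k)%:R^-1 <= h0 ->
    Phi (j%:R / J%:R) y0 <= 1 + C / (J * k)%:R.
  apply/ler_addgt0Pl => eps eps0.
  pose k := maxn 1 (maxn (Num.bound h0^-1) (Num.bound (C / eps))).
  have k0 : (0 < k)%N by rewrite /k leq_max.
  have kJk : (k <= J * k)%N by rewrite leq_pmull.
  have Jk0 : (0 < J * k)%N by rewrite muln_gt0 J0.
  have /main le1 := k0; apply: le_trans (le1 _) _.
    rewrite -[leRHS]invrK lef_pV2 ?posrE ?invr_gt0 ?ltr0n//.
    apply/ltW/(lt_le_trans (archi_boundP _)); first by rewrite invr_ge0 ltW.
    by rewrite ler_nat (leq_trans _ kJk)// /k !leq_max leqnn orbT.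
  rewrite addrC lerD2r ler_pdivrMr ?ltr0n// mulrC -ler_pdivrMr//.
  apply/ltW/(lt_le_trans (archi_boundP _)); first by rewrite divr_ge0// ltW.
  by rewrite ler_nat (leq_trans _ kJk)// /k !leq_max leqnn !orbT.
move=> k0; set N := (J * k)%N; set h : R := N%:R^-1 => hh0.
have N0 : (0 < N)%N by rewrite muln_gt0 J0.
have NR0 : 0 < N%:R :> R by rewrite ltr0n.
have hp : 0 < h by rewrite invr_gt0.
have hN : h * N%:R = 1 by rewrite mulVf ?gt_eqF.
pose c := C / 2 * h ^+ 3.
have c0 : 0 <= c by rewrite mulr_ge0 ?divr_ge0// exprn_ge0 ?ltW.
pose b i := m (i%:R * h) + c * i%:R ^+ 2.
have cN : c * N%:R ^+ 2 <= C / N%:R.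
  rewrite /c (_ : _ * _ = C / 2 * h * (h * N%:R) ^+ 2); last by ring.
  by rewrite hN expr1n mulr1 -/h ler_pM2r//; lra.
have in01 i : (i <= N)%N -> 0 <= i%:R * h <= 1.
  move=> iN; rewrite mulr_ge0 ?(ltW hp)//=.
  by rewrite /h ler_pdivrMr// mul1r ler_nat.
have bi : forall i, (i <= N)%N -> b i <= 1 + C / N%:R.
  apply: convex_seq_le.
  - rewrite /b mul0r expr0n mulr0 addr0 (le_trans (mle _ _ Phi0))// lerDl.
    by rewrite divr_ge0// ltW.
  - by rewrite /b mulrC hN lerD// mle.
  - move=> i iN.
    have x1 := in01 _ iN; have x0 := in01 _ (ltnW (ltnW iN)).
    have xi := in01 _ (ltnW iN).
    have xE : i.+1%:R * h + h = i.+2%:R * h by rewrite -[in RHS]natr1; ring.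
    have xE' : i.+1%:R * h - h = i%:R * h by rewrite -[in LHS]natr1; ring.
    (* The two vertical neighbours are bounded by the supremum on the same line, hence the term
       [2 * m]. Cancelling it leaves near convexity in the horizontal direction alone. *)
    have : 4 * m (i.+1%:R * h) <= m (i.+2%:R * h) + m (i%:R * h) +
        2 * m (i.+1%:R * h) + C * h ^+ 3.
      rewrite mulrC -ler_pdivlMr//; apply: mle => y.
      rewrite ler_pdivlMr// mulrC.
      apply: le_trans (four h _ y _ _ _) _; rewrite ?hp//.
      + by rewrite xE'; case/andP: x0.
      + by rewrite xE; case/andP: x1.
      rewrite xE xE' lerD2r.
      have := mP _ y x1; have := mP _ y x0.
      by have := mP _ (y + h) xi; have := mP _ (y - h) xi; lra.
    rewrite /b -!natr1 /c; set X := m _; set Y := m _; set Z := m _.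
    by move=> ?; nra.
apply: le_trans (bi (j * k)%N _); last by rewrite leq_mul2r jJ orbT.
have -> : j%:R / J%:R = (j * k)%:R * h :> R.
  rewrite /h /N !natrM invfM mulrACA divff ?mulr1// pnatr_eq0.
  by rewrite -lt0n.
rewrite /b -[leLHS]addr0 lerD//; last by rewrite mulr_ge0// sqr_ge0.
by apply: mP; apply: in01; rewrite leq_mul2r jJ orbT.
Qed.

End discrete_three_lines.

Section exponential_family.
Context d (T : measurableType d) (R : realType) (Q : probability T R).
Variables (H : T -> R[i]) (L : T -> R).
Hypotheses (bH : bcfun H) (bL : bfun L).

(** This is [H * exp ((x + i y) L)], an analytic family written with real exponentials and
    phases. *)
Let G x y z := H z * ((expR (x * L z))%:C * cis (y * L z)).

Lemma bcfun_cis (f : T -> R) : bfun f -> bcfun (fun z => cis (f z)).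
Proof. by move=> bf; split => /=; [exact: bfun_cos|exact: bfun_sin]. Qed.

Let bG x y : bcfun (G x y).
Proof.
have bZ a : bfun (fun z => a * L z) by apply: bfunM => //; exact: bfun_cst.
apply: bcfunM => //; apply: bcfunM; last exact: bcfun_cis.
by apply: bcfun_real; exact: bfun_expR.
Qed.

Let Phi x y := normc (Ec Q (G x y)).

(* The mean of [exp (L z)] over the four points [z + h], [z - h], [z + i h] and
   [z - i h] is [exp (L z)] times [(cosh (h L) + cos (h L)) / 2 = 1 + O(h ^ 4)]. *)
Lemma exponential_three_lines : (forall y, Phi 0 y <= 1) -> (forall y, Phi 1 y <= 1) ->
  forall (j J : nat) y, (0 < J)%N -> (j <= J)%N -> Phi (j%:R / J%:R) y <= 1.
Proof.
have [_ [A HA]] := bfun_normc bH.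
have [_ [B0 LB0]] := bL.
pose B := `|B0| + 1; have B_gt0 : 0 < B by rewrite ltr_wpDl.
have LB z : `|L z| <= B.
  by rewrite (le_trans (LB0 z))// (le_trans (ler_norm _))// lerDl.
have HA' z : normc (H z) <= `|A|.
  by rewrite (le_trans _ (ler_norm A))// (le_trans _ (HA z))// ler_norm.
have Gle x y z : 0 <= x <= 1 -> normc (G x y z) <= `|A| * expR B.
  move=> /andP[x0 x1]; rewrite !normcM normc_cis mulr1 normc_real.
  rewrite ler_pM ?normc_ge0// ger0_norm ?expR_ge0// ler_expR.
  apply: le_trans (ler_norm _) _; rewrite normrM (ger0_norm x0).
  by rewrite -[leRHS]mul1r ler_pM.
(* [|A| * expR B] bounds the family on the strip, and a mesh of at most [B^-1] keeps [|h L| <= 1],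
   the range of [cosh_cos_bound]. *)
apply: (@discrete_three_lines _ _ (`|A| * expR B) (2 * (`|A| * expR B) * B ^+ 3) B^-1).
- by rewrite !mulr_ge0 ?exprn_ge0 ?expR_ge0// ltW.
- by rewrite invr_gt0.
- move=> x y x01; apply: le_trans (normc_Ec_le Q (bG x y)) _.
  rewrite -[leRHS](Er_cst Q); apply: Er_le => [||z].
  + exact: bfun_normc.
  + exact: bfun_cst.
  + exact: Gle.
move=> h x y /andP[h0 hB] xm xp.
pose D z := expR (h * L z) + expR (- (h * L z)) + 2 * cos (h * L z) - 4.
have bhL : bfun (fun z => h * L z) by apply: bfunM => //; exact: bfun_cst.
have bD : bfun D.
  apply: bfunB; last exact: bfun_cst.
  apply: bfunD.
    by apply: bfunD; apply: bfun_expR => //; exact: bfunN.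
  by apply: bfunM; [exact: bfun_cst|exact: bfun_cos].
have bGD : bcfun (fun z => G x y z * (D z)%:C) by apply: bcfunM => //; exact: bcfun_real.
have GE z : 4%:C * G x y z = G (x + h) y z + (G (x - h) y z +
    (G x (y + h) z + G x (y - h) z)) - G x y z * (D z)%:C.
  rewrite /G /D !mulrDl !mulNr !expRD !cisD /cis cosN sinN.
  move: (H z) (expR _) (expR _) (expR _) (cos _) (sin _) (cos _) (sin _).
  by move=> [? ?] *; apply: complexP; rewrite /=; ring.
have -> : 4 * Phi x y = normc (4%:C * Ec Q (G x y)).
  by rewrite normcM normc_real ger0_norm.
rewrite -EcZ//; under eq_fun do rewrite GE.
rewrite EcB//; last by do ![exact: bG|apply: bcfunD].
rewrite !EcD//; do ?[by do ![exact: bG|apply: bcfunD]].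
apply: le_trans (le_normcD _ _) _; rewrite normcN; apply: lerD.
  rewrite -!addrA; do 2 (apply: le_trans (le_normcD _ _) _; rewrite lerD2l).
  exact: le_normcD.
apply: le_trans (normc_Ec_le Q bGD) _.
rewrite -[leRHS](Er_cst Q); apply: Er_le => [||z].
- exact: bfun_normc.
- exact: bfun_cst.
have hL : `|h * L z| <= h * B by rewrite normrM (gtr0_norm h0) ler_pM2l.
have hL1 : `|h * L z| <= 1.
  by apply: le_trans hL _; rewrite -(mulVf (lt0r_neq0 B_gt0)) ler_pM2r.
have := cosh_cos_bound hL1; rewrite -/(D z) => Dz.
have Dz' : `|D z| <= 2 * (h * B) ^+ 3.
  apply: le_trans Dz _; rewrite ler_pM2l// lerXn2r ?nnegrE//.
  by rewrite mulr_ge0 ?ltW.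
have x01 : 0 <= x <= 1.
  by apply/andP; split; lra.
rewrite normcM normc_real.
apply: le_trans (ler_pM (normc_ge0 _) (normr_ge0 _) (Gle _ y z x01) Dz') _.
by rewrite exprMn; lra.
Qed.

End exponential_family.

(** * One-variable Riesz projections: endpoint estimates and interpolation *)

Section real_inequalities.
Variable R : realFieldType.
Implicit Types (t : R).

(** For [t = |f| ^ 2] the left side is the squared length of the vector with entries [f] and
    [f ^ j * (1 - |f| ^ 2)], [j < m]. *)
Lemma sum_geometric_square t m :
  t + \sum_(j < m) t ^+ j * (1 - t) ^+ 2 = 1 - t ^+ m * (1 - t).
Proof.
elim: m => [|m IH]; first by rewrite big_ord0; ring.
by rewrite big_ord_recr/= addrA IH (exprS t m); ring.
Qed.

(** The powers of [t] decrease, so [m + 1] copies of [t ^ m * (1 - t)] are at most the telescoping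
    sum of the [t ^ j * (1 - t)], [j <= m]. This makes the defect of length of the completed vector
    uniformly small. *)
Lemma exprn_onem_le t m : 0 <= t <= 1 -> t ^+ m * (1 - t) <= m.+1%:R^-1.
Proof.
move=> /andP[t0 t1].
suff : m.+1%:R * (t ^+ m * (1 - t)) <= 1 - t ^+ m.+1.
  move=> le1; rewrite -[leRHS]mulr1 ler_pdivlMl ?ltr0n//.
  by rewrite (le_trans le1)// gerBl exprn_ge0.
elim: m => [|m IH]; first by rewrite expr0 expr1 !mul1r.
have tm0 : 0 <= t ^+ m by rewrite exprn_ge0.
have tm1 : t ^+ m.+1 <= 1 by rewrite exprn_ile1.
have := ler_wpM2l t0 IH.
have : 0 <= (1 - t) * (1 - t ^+ m.+1) by rewrite mulr_ge0// subr_ge0.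
rewrite (_ : m.+2%:R = m.+1%:R + 1 :> R) ?natr1// !exprS.
set k := m.+1%:R; set y := t ^+ m; nra.
Qed.

Lemma cauchy_schwarz_sum (I : Type) (s : seq I) (a b : I -> R) :
  (\sum_(i <- s) a i * b i) ^+ 2 <=
  (\sum_(i <- s) a i ^+ 2) * (\sum_(i <- s) b i ^+ 2).
Proof.
elim: s => [|i s IH]; first by rewrite !big_nil expr0n mul0r.
rewrite !big_cons; move: IH.
have : 0 <= \sum_(j <- s) b j ^+ 2 by apply: sumr_ge0 => j _; exact: sqr_ge0.
have : 0 <= \sum_(j <- s) a j ^+ 2 by apply: sumr_ge0 => j _; exact: sqr_ge0.
set A := \sum_(j <- s) a j ^+ 2; set B := \sum_(j <- s) b j ^+ 2.
set X := \sum_(j <- s) _; move: (a i) (b i) => p q A0 B0 XAB.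
suff : 2 * (X * (p * q)) <= A * q ^+ 2 + B * p ^+ 2 by nra.
have D0 : 0 <= A * q ^+ 2 + B * p ^+ 2 by rewrite addr_ge0// mulr_ge0// sqr_ge0.
apply: le_trans (ler_norm _) _.
rewrite -ler_sqr ?nnegrE// real_normK ?num_real//.
have h1 : 0 <= (A * q ^+ 2 - B * p ^+ 2) ^+ 2 by exact: sqr_ge0.
have h2 : X ^+ 2 * (p * q) ^+ 2 <= A * B * (p * q) ^+ 2.
  by rewrite ler_wpM2r// sqr_ge0.
nra.
Qed.

End real_inequalities.

(** * Trigonometric polynomials over an abstract orthonormal group of characters *)

Section characters.
Context d (T : measurableType d) (R : realType) (P : probability T R).
Variables (I : zmodType) (e : I -> T -> R[i]).
Hypothesis be : forall a, bcfun (e a).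
Hypothesis eD : forall a b x, e (a + b) x = e a x * e b x.
Hypothesis eN : forall a x, e (- a) x = (e a x)^*.
Hypothesis e0 : forall x, e 0 x = 1.
Hypothesis Ee : forall a, a != 0 -> Ec P (e a) = 0.
Local Notation Ec2 := (Ec (P \x P)%E).
Local Notation Er := (Er P).
Local Notation Ec := (Ec P).
Implicit Types (f g h : T -> R[i]) (a b : I) (E : pred I).

Lemma Ec_e a : Ec (e a) = (a == 0)%:R.
Proof.
have [->|/Ee//] := eqVneq.
by rewrite -[RHS](Ec_cst P); congr Ec; apply/funext => x; rewrite e0.
Qed.

Definition fhat f a : R[i] := Ec (fun x => f x * (e a x)^*).

(** [E] confines the spectrum. No normal form is imposed: terms may repeat, and closure under
    products and the vanishing of the mean go by induction on the terms. *)
Inductive tpoly E : (T -> R[i]) -> Prop :=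
| tpoly0 : tpoly E (fun=> 0)
| tpoly_cons c a f : E a -> tpoly E f -> tpoly E (fun x => c * e a x + f x).

Lemma tpoly_bcfun E f : tpoly E f -> bcfun f.
Proof.
elim=> [|c a g _ _ IH]; first exact: bcfun_cst.
by apply: bcfunD => //; apply: bcfunM => //; exact: bcfun_cst.
Qed.

Lemma tpolyD E f g : tpoly E f -> tpoly E g -> tpoly E (fun x => f x + g x).
Proof.
move=> tf tg; elim: tf => [|c a h Ea _ IH].
  by rewrite (_ : (fun x => _) = g)//; apply/funext => x; rewrite add0r.
rewrite (_ : (fun x => _) = fun x => c * e a x + (h x + g x)); first exact: tpoly_cons.
by apply/funext => x; rewrite addrA.
Qed.

Lemma tpoly_sum E (J : Type) (s : seq J) (p : pred J) (F : J -> T -> R[i]) :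
  (forall j, p j -> tpoly E (F j)) -> tpoly E (fun x => \sum_(j <- s | p j) F j x).
Proof.
move=> tF; elim: s => [|j s IH].
  by under eq_fun do rewrite big_nil; exact: tpoly0.
case pj: (p j); under eq_fun do rewrite big_cons pj; last by [].
by apply: tpolyD => //; exact: tF.
Qed.

Lemma tpoly1 E c a : E a -> tpoly E (fun x => c * e a x).
Proof.
move=> Ea; rewrite (_ : (fun x => _) = fun x => c * e a x + 0).
  exact: (tpoly_cons c Ea (tpoly0 E)).
by apply/funext => x; rewrite addr0.
Qed.

Lemma tpolyM E1 E2 E f g : (forall a b, E1 a -> E2 b -> E (a + b)) ->
  tpoly E1 f -> tpoly E2 g -> tpoly E (fun x => f x * g x).
Proof.
move=> E12 tf tg; elim: tf => [|c a h Ea _ IH].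
  by under eq_fun do rewrite mul0r; exact: tpoly0.
under eq_fun do rewrite mulrDl; apply: tpolyD => //.
elim: tg => [|c' b g' Eb _ IH2].
  by under eq_fun do rewrite mulr0; exact: tpoly0.
under eq_fun do rewrite mulrDr; apply: tpolyD => //.
under eq_fun do rewrite mulrACA -eD.
by apply: tpoly1; exact: E12.
Qed.

Lemma tpolyJ E1 E f : (forall a, E1 a -> E (- a)) ->
  tpoly E1 f -> tpoly E (fun x => (f x)^*).
Proof.
move=> E12; elim=> [|c a h Ea _ IH].
  by under eq_fun do rewrite conjc0; exact: tpoly0.
under eq_fun do rewrite rmorphD rmorphM/= -eN.
by apply: tpoly_cons => //; exact: E12.
Qed.

Lemma tpoly_cst E c : E 0 -> tpoly E (fun=> c).
Proof.
move=> E0; rewrite (_ : (fun=> c) = fun x => c * e 0 x); first exact: tpoly1.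
by apply/funext => x; rewrite e0 mulr1.
Qed.

Lemma tpolyX f n : tpoly predT f -> tpoly predT (fun x => f x ^+ n).
Proof.
move=> tf; elim: n => [|n IH]; first exact: tpoly_cst.
under eq_fun do rewrite exprS; exact: tpolyM tf IH.
Qed.

Lemma tpoly_mean0 E f : ~~ E 0 -> tpoly E f -> Ec f = 0.
Proof.
move=> E0; elim=> [|c a h Ea th IH]; first by rewrite Ec_cst.
rewrite EcD; last exact: tpoly_bcfun th.
  rewrite IH addr0 EcZ// Ee ?mulr0//.
  by apply: contraNneq E0 => <-.
by apply: bcfunM => //; exact: bcfun_cst.
Qed.

Lemma fhat_sum (s : seq I) (c : I -> R[i]) b : uniq s ->
  fhat (fun x => \sum_(a <- s) c a * e a x) b = if b \in s then c b else 0.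
Proof.
move=> us; rewrite /fhat; under eq_fun do rewrite mulr_suml.
rewrite Ec_sum; last first.
  move=> a; apply: bcfunM; last by apply: bcfunJ; exact: be.
  by apply: bcfunM => //; exact: bcfun_cst.
transitivity (\sum_(a <- s) if a == b then c a else 0).
  apply: eq_bigr => a _; under eq_fun do rewrite -mulrA -eN -eD.
  rewrite EcZ// Ec_e subr_eq0.
  by case: eqP => [->|]; rewrite ?mulr1 ?mulr0.
rewrite -big_mkcond/=; case: ifPn => bs.
  rewrite (big_rem b)//= eqxx big1_seq ?addr0// => a /andP[/eqP -> ].
  by rewrite mem_rem_uniq// inE eqxx.
by rewrite big1_seq// => a /andP[/eqP -> ab]; rewrite ab in bs.
Qed.

Lemma bcfun_esum (s : seq I) (c : I -> R[i]) :
  bcfun (fun x => \sum_(a <- s) c a * e a x).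
Proof.
by apply: bcfun_sum => a; apply: bcfunM => //; exact: bcfun_cst.
Qed.

Lemma Ec_mul_conj_sum f (s : seq I) (c : I -> R[i]) : bcfun f ->
  Ec (fun x => f x * (\sum_(a <- s) c a * e a x)^*) =
  \sum_(a <- s) (c a)^* * fhat f a.
Proof.
move=> bf; have bfe a : bcfun (fun x => f x * (e a x)^*).
  by apply: bcfunM => //; exact: bcfunJ.
under eq_fun do rewrite rmorph_sum mulr_sumr/=.
rewrite Ec_sum => [|a].
  apply: eq_bigr => a _; rewrite -EcZ//; congr Ec; apply/funext => x.
  by rewrite rmorphM/= mulrCA.
under eq_fun do rewrite rmorphM/= mulrCA.
by apply: bcfunM => //; exact: bcfun_cst.
Qed.

Lemma Er_sqr_normc_sum (s : seq I) (c : I -> R[i]) : uniq s ->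
  Er (fun x => normc (\sum_(a <- s) c a * e a x) ^+ 2) =
  \sum_(a <- s) normc (c a) ^+ 2.
Proof.
move=> us; apply: complexI; rewrite -Ec_sqr_normc Ec_mul_conj_sum; last first.
  exact: bcfun_esum.
rewrite rmorph_sum/=; apply: eq_big_seq => a sa.
by rewrite fhat_sum// sa mulrC; exact/esym/sqr_normcE.
Qed.

Lemma bessel f (s : seq I) : bcfun f -> uniq s ->
  \sum_(a <- s) normc (fhat f a) ^+ 2 <= Er (fun x => normc (f x) ^+ 2).
Proof.
move=> bf us; pose G x := \sum_(a <- s) fhat f a * e a x.
have bG : bcfun G by exact: bcfun_esum.
have bfG : bcfun (fun x => f x * (G x)^*) by apply: bcfunM => //; exact: bcfunJ.
have normB x : normc (f x - G x) ^+ 2 =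
    normc (f x) ^+ 2 + ((-2) * complex.Re (f x * (G x)^*) + normc (G x) ^+ 2).
  by rewrite !sqr_normc2 !cReImE; ring.
have : 0 <= Er (fun x => normc (f x - G x) ^+ 2).
  by apply: Er_ge0 => x; exact: sqr_ge0.
have [rfG _] := bfG.
under eq_fun do rewrite normB.
rewrite ErD; last 2 first.
- exact/bfunX/bfun_normc.
- apply: bfunD; first by apply: bfunM => //; exact: bfun_cst.
  exact/bfunX/bfun_normc.
rewrite ErD; last 2 first.
- by apply: bfunM => //; exact: bfun_cst.
- exact/bfunX/bfun_normc.
rewrite ErZ// -Re_Ec Ec_mul_conj_sum// Er_sqr_normc_sum//.
have -> : \sum_(a <- s) (fhat f a)^* * fhat f a =
    (\sum_(a <- s) normc (fhat f a) ^+ 2)%:C.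
  rewrite rmorph_sum; apply: eq_bigr => a _.
  by rewrite mulrC; exact/esym/sqr_normcE.
by move=> /=; lra.
Qed.

(** * Projection onto a half-space of frequencies *)

Section half_space.
Variable dg : I -> int.
Hypothesis dgD : forall a b, dg (a + b) = dg a + dg b.

Lemma dg0 : dg 0 = 0.
Proof. by apply: (addrI (dg 0)); rewrite -dgD !addr0. Qed.

Lemma dgN a : dg (- a) = - dg a.
Proof. by apply: (addrI (dg a)); rewrite -dgD !subrr dg0. Qed.

Local Notation nneg := (fun a => 0 <= dg a).
Local Notation pos := (fun a => 0 < dg a).

Lemma tpoly_split f : tpoly predT f -> exists gh : (T -> R[i]) * (T -> R[i]),
  [/\ tpoly nneg gh.1, tpoly pos gh.2 & forall x, f x = gh.1 x + (gh.2 x)^*].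
Proof.
elim=> [|c a f' _ _ [[g h]/= [tg th fE]]].
  exists (fun=> 0, fun=> 0); split=> /=; [exact: tpoly0|exact: tpoly0|].
  by move=> x; apply: complexP; rewrite cReImE/= ?oppr0 addr0.
have [a0|a0] := leP 0 (dg a).
  exists (fun x => c * e a x + g x, h); split=> //=; first exact: tpoly_cons.
  by move=> x /=; rewrite fE addrA.
exists (g, fun x => c^* * e (- a) x + h x); split=> //=.
  by apply: tpoly_cons => //; rewrite dgN oppr_gt0.
by move=> x /=; rewrite fE rmorphD rmorphM/= eN !conjcK addrCA.
Qed.

(* With [F = sum_j G j * H j], the hypothesis reads [S + K + 2 Re F = 1 - rho],
   where [S] and [K] are the squared lengths of [G] and [H]. Squaring it and using
   [4 (Re F) ^ 2 = 2 |F| ^ 2 + 2 Re (F ^ 2)] and [|F| ^ 2 <= S K] bounds [S ^ 2],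
   because [F] and [F ^ 2] have only positive frequencies, hence mean zero. *)
Lemma L4_family m (G H : nat -> T -> R[i]) (rho : T -> R) eps :
  (forall j, tpoly nneg (G j)) -> (forall j, tpoly pos (H j)) ->
  (forall x, 0 <= rho x <= eps) ->
  (forall x, \sum_(j < m) normc (G j x + (H j x)^*) ^+ 2 = 1 - rho x) ->
  Er (fun x => (\sum_(j < m) normc (G j x) ^+ 2) ^+ 2) <= 1 + 2 * eps.
Proof.
move=> tG tH rhoe GH.
pose F x := \sum_(j < m) G j x * H j x.
have tF : tpoly pos F.
  apply: tpoly_sum => j _; apply: (tpolyM _ (tG j) (tH j)) => a b a0 b0.
  by rewrite dgD ltr_wpDl.
have tF2 : tpoly pos (fun x => F x * F x).
  by apply: (tpolyM _ tF tF) => a b a0 b0; rewrite dgD addr_gt0.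
have npos0 : ~~ pos 0 by rewrite dg0 ltxx.
have EF := congr1 (@complex.Re R) (tpoly_mean0 npos0 tF).
have EF2 := congr1 (@complex.Re R) (tpoly_mean0 npos0 tF2).
rewrite Re_Ec/= in EF; rewrite Re_Ec/= in EF2.
have [rF _] := tpoly_bcfun tF; have [rF2 _] := tpoly_bcfun tF2.
pose S x := \sum_(j < m) normc (G j x) ^+ 2.
pose K x := \sum_(j < m) normc (H j x) ^+ 2.
have bS : bfun S.
  by apply: bfun_sum => j; apply/bfunX/bfun_normc/tpoly_bcfun/tG.
have SK x : S x + K x + 2 * complex.Re (F x) = 1 - rho x.
  rewrite -GH /S /K /F.
  elim: m {GH F tF tF2 EF EF2 rF rF2 S K bS} => [|m IH].
    by rewrite !big_ord0 /= mulr0 !addr0.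
  rewrite !big_ord_recr/= -IH !sqr_normc2 !cReImE; ring.
have FSK x : normc (F x) ^+ 2 <= S x * K x.
  apply: le_trans (cauchy_schwarz_sum _ _ _).
  rewrite ler_sqr ?nnegrE ?normc_ge0//; last first.
    by apply: sumr_ge0 => j _; rewrite mulr_ge0 ?normc_ge0.
  apply: le_trans (ler_normc_sum _ _) _.
  by apply: ler_sum => j _; rewrite normcM.
have S0 x : 0 <= S x by apply: sumr_ge0 => j _; exact: sqr_ge0.
have K0 x : 0 <= K x by apply: sumr_ge0 => j _; exact: sqr_ge0.
(* Squaring leaves a cross term [4 rho Re F], whose mean is unknown. Since [2 Re F <= S + K] and
   [rho <= eps], it is at most [2 eps (S + K)], and [S + K = 1 - rho - 2 Re F] makes this affine in
   [Re F] again: hence [2 * eps] and the coefficient [4 + 4 * eps]. *)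
have main x : S x ^+ 2 <= (1 + 2 * eps) +
    ((- (4 + 4 * eps)) * complex.Re (F x) + 2 * complex.Re (F x * F x)).
  have r1 : rho x <= 1.
    by rewrite -subr_ge0 -GH; apply: sumr_ge0 => j _; exact: sqr_ge0.
  have /andP[r0 re] := rhoe x; have := SK x; have := FSK x; have := S0 x.
  have := K0 x; rewrite cReImE sqr_normc2.
  move: (S x) (K x) (complex.Re (F x)) (complex.Im (F x)) (rho x) r1 r0 re.
  move=> s k u v r r1 r0 re k0 s0 uv skE.
  have u2 : 2 * u <= s + k.
    apply: le_trans (ler_norm _) _; rewrite -ler_sqr ?nnegrE ?addr_ge0//.
    rewrite real_normK ?num_real//.
    by have := sqr_ge0 v; have := sqr_ge0 (s - k); nra.
  have : r * (2 * u) <= r * (s + k) by rewrite ler_wpM2l.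
  have : r * (s + k) <= eps * (s + k) by rewrite ler_wpM2r// addr_ge0.
  have eps0 : 0 <= eps by exact: le_trans re.
  have : 0 <= eps * r by rewrite mulr_ge0.
  have : (s + k) ^+ 2 = (1 - r - 2 * u) ^+ 2 by congr (_ ^+ 2); rewrite -skE; ring.
  nra.
apply: le_trans (Er_le P _ _ main) _.
- exact: bfunX.
- by do ![apply: bfunD|apply: bfunM|exact: bfun_cst|exact: rF|exact: rF2].
- rewrite ErD ?Er_cst; last 2 first.
  + exact: bfun_cst.
  + by do ![apply: bfunD|apply: bfunM|exact: bfun_cst|exact: rF|exact: rF2].
  rewrite ErD ?ErZ// ?EF ?EF2 ?mulr0 ?addr0//;
  by do ![apply: bfunM|exact: bfun_cst|exact: rF|exact: rF2].
Qed.

(* [f] need not be unimodular: it is completed to a vector of trigonometric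
   polynomials of nearly constant length by [f ^ j * (1 - |f| ^ 2)], [j < m]. *)
Lemma L4_tpoly f g h : tpoly nneg g -> tpoly pos h ->
  (forall x, f x = g x + (h x)^*) -> (forall x, normc (f x) <= 1) ->
  Er (fun x => normc (g x) ^+ 4) <= 1.
Proof.
move=> tg th fE f1.
have tf : tpoly predT f.
  rewrite (_ : f = fun x => g x + (h x)^*); last exact/funext.
  have sub E : forall f', tpoly E f' -> tpoly predT f'.
    by move=> f'; elim=> [|c a k _ _ IH]; [exact: tpoly0|exact: tpoly_cons].
  by apply: tpolyD; [exact: sub tg|apply: tpolyJ th].
pose t x := normc (f x) ^+ 2.
have t01 x : 0 <= t x <= 1.
  by rewrite sqr_ge0/= -(expr1n _ 2) ler_sqr ?nnegrE ?normc_ge0.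
have tphi j : tpoly predT (fun x => f x ^+ j * (1 - f x * (f x)^*)).
  apply: (@tpolyM predT predT) => //; first exact: tpolyX.
  rewrite (_ : (fun x => _) = (fun x => 1 + (-1) * (f x * (f x)^*))); last first.
    by apply/funext => x; rewrite mulN1r.
  apply: tpolyD; first exact: tpoly_cst.
  apply: (@tpolyM predT predT) => //; first exact: tpoly_cst.
  by apply: (@tpolyM predT predT) => //; exact: (@tpolyJ predT).
have [GH GHP] := choice (fun j => tpoly_split (tphi j)).
pose G j := if j is i.+1 then (GH i).1 else g.
pose H j := if j is i.+1 then (GH i).2 else h.
have b4 : bfun (fun x => normc (g x) ^+ 4).
  by apply/bfunX/bfun_normc/tpoly_bcfun/tg.
have step m : Er (fun x => normc (g x) ^+ 4) <= 1 + 2 * m.+1%:R^-1.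
  have := @L4_family m.+1 G H (fun x => t x ^+ m * (1 - t x)) (m.+1%:R^-1).
  move=> /(_ _ _ _ _) L; apply: le_trans (L _ _ _ _).
  - apply: Er_le => //.
      apply: bfunX; apply: bfun_sum => j.
      apply/bfunX/bfun_normc/(@tpoly_bcfun nneg).
      by case: j => -[|j] _ //=; have [] := GHP j.
    move=> x; rewrite (exprM _ 2 2) ler_sqr ?nnegrE ?sqr_ge0//; last first.
      by apply: sumr_ge0 => j _; exact: sqr_ge0.
    by rewrite big_ord_recl/= lerDl; apply: sumr_ge0 => j _; exact: sqr_ge0.
  - by case=> [|j]//=; have [] := GHP j.
  - by case=> [|j]//=; have [] := GHP j.
  - move=> x; have /andP[t0 t1] := t01 x; apply/andP; split.
      by apply: mulr_ge0; [exact: exprn_ge0|rewrite subr_ge0].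
    exact: exprn_onem_le.
  - move=> x; rewrite -sum_geometric_square big_ord_recl/= -fE; congr (_ + _).
    apply: eq_bigr => j _; have [_ _ <-] := GHP j.
    rewrite normcM exprMn normcX exprAC -/(t x) -sqr_normcE.
    rewrite (_ : 1 - _ = (1 - t x)%:C); last by rewrite rmorphB.
    rewrite normc_real ger0_norm// subr_ge0.
    by case/andP: (t01 x).
apply/ler_addgt0Pl => eps eps0.
have [m mP] : exists m : nat, 2 * m.+1%:R^-1 <= eps.
  exists (Num.bound (2 / eps)); rewrite ler_pdivrMr ?ltr0n// mulrC -ler_pdivrMr//.
  have := archi_boundP (ltW (divr_gt0 (ltr0n R 2) eps0)).
  by move=> /ltW/le_trans; apply; rewrite ler_nat.
by rewrite (le_trans (step m))// addrC lerD2r.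
Qed.

Variables (S : seq I) (w : I -> R).
Hypothesis uS : uniq S.
Hypothesis S0 : 0 \in S.
Hypothesis w01 : forall a, 0 <= w a <= 1.
Hypothesis w0 : w 0 = 1.
Hypothesis kernel_ge0 : forall x y, exists r : R, 0 <= r /\
  \sum_(a <- S) (w a)%:C * (e a x * (e a y)^*) = r%:C.

Definition fejer f x := \sum_(a <- S) (w a)%:C * fhat f a * e a x.

Definition rfejer f x :=
  \sum_(a <- S | 0 <= dg a) (w a)%:C * fhat f a * e a x.

(** [fejer f x] is the mean of [f] against a nonnegative kernel, whose total mass is its coefficient
    [w 0 = 1] at the trivial character. *)
Lemma fejer_le1 f : bcfun f -> (forall x, normc (f x) <= 1) ->
  forall x, normc (fejer f x) <= 1.
Proof.
move=> bf f1 x.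
pose K y := \sum_(a <- S) (w a)%:C * (e a x * (e a y)^*).
have bK : bcfun K.
  apply: bcfun_sum => a; apply: bcfunM; first exact: bcfun_cst.
  by apply: bcfunM; [exact: bcfun_cst|exact/bcfunJ].
have -> : fejer f x = Ec (fun y => f y * K y).
  rewrite /K; under eq_fun do rewrite mulr_sumr.
  have bfe a : bcfun (fun y => f y * (e a y)^*).
    by apply: bcfunM => //; exact: bcfunJ.
  rewrite Ec_sum => [|a].
    apply: eq_bigr => a _.
    rewrite mulrAC -EcZ//; congr Ec; apply/funext => y.
    by rewrite mulrCA; congr (_ * _); rewrite mulrA.
  apply: bcfunM => //; apply: bcfunM; first exact: bcfun_cst.
  by apply: bcfunM; [exact: bcfun_cst|exact/bcfunJ].
have EK : Er (fun y => complex.Re (K y)) = 1.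
  rewrite -Re_Ec /K Ec_sum => [|a]; last first.
    apply: bcfunM; first exact: bcfun_cst.
    by apply: bcfunM; [exact: bcfun_cst|exact/bcfunJ].
  rewrite (big_rem 0)//= big1_seq => [|a /andP[_ aS]].
    rewrite addr0 EcZ; last by apply: bcfunM; [exact: bcfun_cst|exact/bcfunJ].
    under eq_fun do rewrite !e0 mul1r conjc1.
    by rewrite Ec_cst mulr1 /= w0.
  rewrite EcZ; last by apply: bcfunM; [exact: bcfun_cst|exact/bcfunJ].
  rewrite EcZ ?EcJ ?Ee ?rmorph0 ?mulr0//; last exact/bcfunJ.
  by apply: contraTneq aS => ->; rewrite mem_rem_uniq// inE eqxx.
have [rK _] := bK.
apply: le_trans (normc_Ec_le P (bcfunM bf bK)) _.
rewrite -EK; apply: Er_le => //.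
  exact/bfun_normc/bcfunM.
move=> y; have [r [r0 KE]] := kernel_ge0 x y.
rewrite normcM /K KE normc_real ger0_norm//=.
by rewrite -[leRHS]mul1r ler_wpM2r.
Qed.

Lemma bcfun_rfejer f : bcfun (rfejer f).
Proof.
by rewrite /rfejer; under eq_fun do rewrite -big_filter; exact: bcfun_esum.
Qed.

(** The Fejer mean turns a bounded function into a trigonometric polynomial with the same bound,
    which is what [L4_tpoly] takes; the conjugated terms of negative degree supply its [h]. *)
Lemma rfejer_L4 f : bcfun f -> (forall x, normc (f x) <= 1) ->
  Er (fun x => normc (rfejer f x) ^+ 4) <= 1.
Proof.
move=> bf f1.
pose h x := \sum_(a <- S | ~~ (0 <= dg a)) ((w a)%:C * fhat f a)^* * e (- a) x.
apply: (@L4_tpoly (fejer f) _ h).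
- by apply: tpoly_sum => a a0; exact: tpoly1.
- by apply: tpoly_sum => a a0; apply: tpoly1; rewrite dgN oppr_gt0 ltNge.
- move=> x; rewrite /fejer (bigID (fun a => 0 <= dg a))/=; congr (_ + _).
  rewrite /h rmorph_sum/=; apply: eq_bigr => a _.
  by rewrite -[LHS]conjcK; congr conjc; rewrite rmorphM eN.
- exact: fejer_le1.
Qed.

Lemma rfejer_L2 f : bcfun f ->
  Er (fun x => normc (rfejer f x) ^+ 2) <= Er (fun x => normc (f x) ^+ 2).
Proof.
move=> bf; rewrite /rfejer; under eq_fun do rewrite -big_filter.
rewrite Er_sqr_normc_sum ?filter_uniq//.
apply: le_trans (bessel bf (filter_uniq _ uS)).
apply: ler_sum => a _; rewrite normcM normc_real exprMn.
have /andP[wa0 wa1] := w01 a.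
rewrite -[leRHS]mul1r ler_wpM2r ?sqr_ge0// ger0_norm//.
by rewrite exprn_ile1.
Qed.

(* The analytic family joins the [L^2 -> L^2] bound at [x = 0] to the
   [L^oo -> L^4] bound at [x = 1]; both are used through Young's inequality. *)
Lemma exponential_interpolation (M M' : T -> R) (u v : T -> R[i]) (j J : nat)
    (th := j%:R / J%:R : R) :
  bfun M -> bfun M' -> bcfun u -> bcfun v ->
  (forall x, normc (u x) <= 1) -> (forall x, normc (v x) <= 1) ->
  Er (fun x => expR (M x)) <= 1 -> Er (fun x => expR (M' x)) <= 1 ->
  (0 < J)%N -> (j <= J)%N ->
  normc (Ec (fun t => v t * (expR ((2^-1 + th / 4) * M' t))%:C *
    rfejer (fun s => u s * (expR ((1 - th) / 2 * M s))%:C) t)) <= 1.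
Proof.
move=> bM bM' bu bv u1 v1 EM EM' J0 jJ.
(* With [z = x + i y] these are [u exp ((1 - z) M / 2)] and [v exp ((1/2 + z/4) M')]. At [x = 0]
   their squares are at most [exp M] and [exp M'] in modulus; at [x = 1] the first is at most 1 and
   the second at most [exp (3 M' / 4)], where [4/3] is the exponent dual to 4. *)
pose f x y s := u s * ((expR ((1 - x) / 2 * M s))%:C * cis (- (y * (M s / 2)))).
pose g x y t := v t * ((expR ((2^-1 + x / 4) * M' t))%:C * cis (y * (M' t / 4))).
have bZ (k : R) (N : T -> R) : bfun N -> bfun (fun s : T => k * N s).
  by move=> bN; apply: bfunM => //; exact: bfun_cst.
have bZr (k : R) (N : T -> R) : bfun N -> bfun (fun s : T => N s * k).
  by move=> bN; apply: bfunM => //; exact: bfun_cst.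
have bf x y : bcfun (f x y).
  apply: bcfunM => //; apply: bcfunM.
    by apply: bcfun_real; apply: bfun_expR; exact: bZ.
  by apply: bcfun_cis; apply: bfunN; apply: bZ; exact: bZr.
have bg x y : bcfun (g x y).
  apply: bcfunM => //; apply: bcfunM.
    by apply: bcfun_real; apply: bfun_expR; exact: bZ.
  by apply: bcfun_cis; apply: bZ; exact: bZr.
pose sf := [seq a <- S | 0 <= dg a].
(* Writing [rfejer] by its kernel turns the pairing into one expectation over [T * T]. All
   dependence on the complex parameter sits in a factor [exp ((x + i y) L)], as
   [exponential_three_lines] requires. *)
pose H (z : T * T) := u z.1 * v z.2 * (expR (M z.1 / 2 + M' z.2 / 2))%:C *
  \sum_(a <- sf) (w a)%:C * ((e a z.1)^* * e a z.2).
pose L (z : T * T) := M' z.2 / 4 - M z.1 / 2.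
have bL : bfun L.
  by apply: bfunB; [apply: (@bfun_snd _ _ T T R (fun t => M' t / 4))
    |apply: (@bfun_fst _ _ T T R (fun t => M t / 2))]; exact: bZr.
have bK a : bcfun (fun z : T * T => (w a)%:C * ((e a z.1)^* * e a z.2)).
  apply: bcfunM; first exact: bcfun_cst.
  apply: bcfunM; last exact: bcfun_snd.
  by apply: (@bcfun_fst _ _ T T R (fun s => (e a s)^*)); exact: bcfunJ.
have bH : bcfun H.
  apply: bcfunM; last exact: bcfun_sum.
  apply: bcfunM.
    by apply: bcfunM; [exact: bcfun_fst|exact: bcfun_snd].
  apply: bcfun_real; apply: bfun_expR; apply: bfunD.
    by apply: (@bfun_fst _ _ T T R (fun t => M t / 2)); exact: bZr.
  by apply: (@bfun_snd _ _ T T R (fun t => M' t / 2)); exact: bZr.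
pose pair x y := Ec (fun t => g x y t * rfejer (f x y) t).
have pairE x y : pair x y =
    Ec2 (fun z => H z * ((expR (x * L z))%:C * cis (y * L z))).
  have HE z : H z * ((expR (x * L z))%:C * cis (y * L z)) =
      \sum_(a <- sf) (w a)%:C * ((f x y z.1 * (e a z.1)^*) * (g x y z.2 * e a z.2)).
    rewrite /H mulrAC mulr_sumr; apply: eq_bigr => a _.
    have -> : u z.1 * v z.2 * (expR (M z.1 / 2 + M' z.2 / 2))%:C *
        ((expR (x * L z))%:C * cis (y * L z)) = f x y z.1 * g x y z.2.
      have eE : expR (M z.1 / 2 + M' z.2 / 2) * expR (x * L z) =
          expR ((1 - x) / 2 * M z.1) * expR ((2^-1 + x / 4) * M' z.2).
        by rewrite -!expRD; congr expR; rewrite /L; field.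
      have cE : cis (y * L z) = cis (- (y * (M z.1 / 2))) * cis (y * (M' z.2 / 4)).
        by rewrite -cisD; congr cis; rewrite /L; ring.
      have eC := congr1 (real_complex R) eE; rewrite !rmorphM in eC.
      rewrite /f /g cE; move: (cis _) (cis _) => k1 k2.
      transitivity (u z.1 * v z.2 * ((expR (M z.1 / 2 + M' z.2 / 2))%:C *
        (expR (x * L z))%:C) * (k1 * k2)); first by ring.
      by rewrite eC; ring.
    by ring.
  under [in RHS]eq_fun do rewrite HE.
  have bfe a : bcfun (fun s => f x y s * (e a s)^*).
    by apply: bcfunM => //; exact: bcfunJ.
  have bge a : bcfun (fun t => g x y t * e a t) by apply: bcfunM.
  have bfg a : bcfun (fun z : T * T =>
      (f x y z.1 * (e a z.1)^*) * (g x y z.2 * e a z.2)).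
    apply: bcfunM; last exact: (@bcfun_snd _ _ T T R (fun t => g x y t * e a t)).
    exact: (@bcfun_fst _ _ T T R (fun s => f x y s * (e a s)^*)).
  rewrite Ec_sum => [|a]; last by apply: bcfunM => //; exact: bcfun_cst.
  rewrite /pair /rfejer; under eq_fun do rewrite -big_filter mulr_sumr.
  rewrite Ec_sum => [|a]; last first.
    apply: bcfunM => //; apply: bcfunM => //; exact: bcfun_cst.
  apply: eq_bigr => a _; rewrite EcZ// (Ec_prod P P (bfe a) (bge a)).
  under eq_fun do rewrite mulrCA.
  by rewrite EcZ// mulrA.
have bgT x y : bcfun (fun t => g x y t * rfejer (f x y) t).
  by apply: bcfunM => //; exact: bcfun_rfejer.
have bgn x y : bfun (fun t => normc (g x y t)) by exact: bfun_normc.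
have bTn x y : bfun (fun t => normc (rfejer (f x y) t)).
  by apply: bfun_normc; exact: bcfun_rfejer.
have fle x y s : normc (f x y s) <= expR ((1 - x) / 2 * M s).
  rewrite !normcM normc_cis mulr1 normc_real ger0_norm ?expR_ge0//.
  by rewrite ler_piMl ?expR_ge0.
have gle x y t : normc (g x y t) <= expR ((2^-1 + x / 4) * M' t).
  rewrite !normcM normc_cis mulr1 normc_real ger0_norm ?expR_ge0//.
  by rewrite ler_piMl ?expR_ge0.
have pair0 y : normc (pair 0 y) <= 1.
  apply: le_trans (normc_Ec_le P (bgT 0 y)) _.
  apply: (@le_trans _ _ (Er (fun t => 2^-1 * expR (M' t) +
      2^-1 * normc (rfejer (f 0 y) t) ^+ 2))).
    apply: Er_le => [||t].
    - exact: bfun_normc.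
    - by apply: bfunD; apply: bZ; [exact: bfun_expR|exact: bfunX].
    rewrite normcM; have := gle 0 y t; have := normc_ge0 (g 0 y t).
    have := normc_ge0 (rfejer (f 0 y) t).
    have -> : (2^-1 + 0 / 4) * M' t = M' t / 2 by field.
    have -> : expR (M' t) = expR (M' t / 2) ^+ 2.
      by rewrite expr2 -expRD; congr expR; field.
    move: (normc (rfejer _ _)) (normc (g _ _ _)) (expR _) => A B E A0 B0 BE.
    have : B * A <= E * A by exact: ler_wpM2r.
    by have := sqr_ge0 (A - E); lra.
  rewrite ErD; last 2 first.
  - by apply: bZ; exact: bfun_expR.
  - by apply: bZ; exact: bfunX.
  rewrite !ErZ; [|exact: bfunX|exact: bfun_expR].
  have := rfejer_L2 (bf 0 y).
  have : Er (fun s => normc (f 0 y s) ^+ 2) <= Er (fun s => expR (M s)).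
    apply: Er_le => [||s].
    - exact/bfunX/bfun_normc.
    - exact: bfun_expR.
    have -> : expR (M s) = expR ((1 - 0) / 2 * M s) ^+ 2.
      by rewrite expr2 -expRD; congr expR; field.
    by rewrite lerXn2r ?nnegrE ?normc_ge0 ?expR_ge0.
  lra.
have pair1 y : normc (pair 1 y) <= 1.
  apply: le_trans (normc_Ec_le P (bgT 1 y)) _.
  apply: (@le_trans _ _ (Er (fun t => 3 / 4 * expR (M' t) +
      4^-1 * normc (rfejer (f 1 y) t) ^+ 4))).
    apply: Er_le => [||t].
    - exact: bfun_normc.
    - by apply: bfunD; apply: bZ; [exact: bfun_expR|exact: bfunX].
    rewrite normcM; have := gle 1 y t; have := normc_ge0 (g 1 y t).
    have := normc_ge0 (rfejer (f 1 y) t); have := expR_ge0 (M' t / 4).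
    have -> : expR ((2^-1 + 1 / 4) * M' t) = expR (M' t / 4) ^+ 3.
      by rewrite -expRM_natl; congr expR; field.
    have -> : expR (M' t) = expR (M' t / 4) ^+ 4.
      by rewrite -expRM_natl; congr expR; field.
    move: (normc (rfejer _ _)) (normc (g _ _ _)) (expR _) => A B E E0 A0 B0 BE.
    have : B * A <= E ^+ 3 * A by exact: ler_wpM2r.
    have : 0 <= (E - A) ^+ 2 * (3 * E ^+ 2 + 2 * E * A + A ^+ 2).
      by rewrite mulr_ge0 ?sqr_ge0// !addr_ge0 ?mulr_ge0 ?sqr_ge0.
    have -> : (E - A) ^+ 2 * (3 * E ^+ 2 + 2 * E * A + A ^+ 2) =
      3 * E ^+ 4 + A ^+ 4 - 4 * (E ^+ 3 * A) by ring.
    by lra.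
  rewrite ErD; last 2 first.
  - by apply: bZ; exact: bfun_expR.
  - by apply: bZ; exact: bfunX.
  rewrite !ErZ; [|exact: bfunX|exact: bfun_expR].
  have : Er (fun t => normc (rfejer (f 1 y) t) ^+ 4) <= 1.
    apply: rfejer_L4 => // s; apply: le_trans (fle 1 y s) _.
    by rewrite subrr !mul0r expR0.
  lra.
have := @exponential_three_lines _ _ _ (P \x P)%E H L bH bL.
move=> /(_ _ _ j J 0 J0 jJ); rewrite -/th -pairE => tl.
have -> : (fun t => v t * (expR ((2^-1 + th / 4) * M' t))%:C *
    rfejer (fun s => u s * (expR ((1 - th) / 2 * M s))%:C) t) =
    (fun t => g th 0 t * rfejer (f th 0) t).
  apply/funext => t; rewrite /g mul0r cis0 mulr1; congr (_ * rfejer _ _).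
  by apply/funext => s; rewrite /f mul0r oppr0 cis0 mulr1.
by apply: tl => y; rewrite -pairE.
Qed.

(* The positive floor [delta] keeps the logarithm bounded. *)
Lemma log_factor (F : T -> R[i]) (p X delta : R) : bcfun F -> 0 < p -> 0 < delta ->
  Er (fun x => normc (F x) `^ p) <= X ->
  exists (u : T -> R[i]) (M : T -> R), [/\ bcfun u, bfun M,
    (forall x, normc (u x) <= 1), Er (fun x => expR (M x)) <= 1 &
    forall x, F x = u x * (expR (p^-1 * M x) * (X + delta) `^ p^-1)%:C].
Proof.
move=> bF p0 d0 FX.
have nF0 x : 0 <= normc (F x) by exact: normc_ge0.
have bnF : bfun (fun x => normc (F x)) by exact: bfun_normc.
have X0 : 0 <= X by apply: le_trans FX; apply: Er_ge0 => x; exact: powR_ge0.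
have Xd0 : 0 < X + delta by rewrite ltr_wpDl.
(* Chosen so that [eta ^ p = delta]: raising [|F|] to this floor adds at most [delta] to its [p]-th
   moment. *)
pose eta := delta `^ p^-1; have eta0 : 0 < eta by exact: powR_gt0.
have etap : eta `^ p = delta by rewrite -powRrM mulVf ?gt_eqF// powRr1// ltW.
pose m x := Num.max (normc (F x)) eta.
have em x : eta <= m x by rewrite le_max lexx orbT.
have Fm x : normc (F x) <= m x by rewrite le_max lexx.
have m0 x : 0 < m x by exact: lt_le_trans (em x).
have bm : bfun m by apply: bfun_max => //; exact: bfun_cst.
have bln : bfun (fun x => ln (m x)).
  have [mm [B mB]] := bm; split; first exact: (measurableT_comp (@measurable_ln R) mm).
  exists (`|ln eta| + `|ln B|) => x.
  have mxB : m x <= B by rewrite (le_trans (ler_norm _)).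
  have B0 : 0 < B by rewrite (lt_le_trans (m0 x)).
  have l1 : ln eta <= ln (m x) by rewrite ler_ln ?posrE.
  have l2 : ln (m x) <= ln B by rewrite ler_ln ?posrE.
  have := ler_norm (ln B); have := ler_norm (- ln eta); rewrite normrN.
  by rewrite ler_norml; move=> ? ?; apply/andP; split;
    have := normr_ge0 (ln B); have := normr_ge0 (ln eta); lra.
have bminv : bfun (fun x => (m x)^-1).
  have -> : (fun x => (m x)^-1) = (fun x => expR (- ln (m x))).
    by apply/funext => x; rewrite expRN lnK// posrE.
  by apply: bfun_expR; exact: bfunN.
exists (fun x => F x * (m x)^-1%:C), (fun x => p * ln (m x) - ln (X + delta)).
have eM x : expR (p * ln (m x) - ln (X + delta)) = (X + delta)^-1 * m x `^ p.
  rewrite expRD expRN lnK ?posrE// mulrC; congr (_ * _).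
  by rewrite /powR gt_eqF.
split.
- by apply: bcfunM => //; exact: bcfun_real.
- apply: bfunB; last exact: bfun_cst.
  by apply: bfunM => //; exact: bfun_cst.
- move=> x; rewrite normcM normc_real ger0_norm ?invr_ge0 ?(ltW (m0 x))//.
  by rewrite ler_pdivrMr// mul1r.
- under eq_fun do rewrite eM.
  have bFp : bfun (fun x => normc (F x) `^ p) by apply: bfun_powR => //; exact: ltW.
  have bmp : bfun (fun x => m x `^ p) by apply: bfun_powR => [|x|//]; exact: ltW.
  rewrite ErZ// mulrC ler_pdivrMr// mul1r.
  apply: (@le_trans _ _ (Er (fun x => normc (F x) `^ p + delta))).
    apply: Er_le => // [|x]; first by apply: bfunD => //; exact: bfun_cst.
    rewrite /m /Num.max; case: ifP => _; last by rewrite lerDl ltW.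
    by rewrite etap lerDr powR_ge0.
  by rewrite ErD// ?Er_cst ?lerD2r//; exact: bfun_cst.
- move=> x; rewrite (_ : expR _ * _ = m x).
    by rewrite -mulrA -rmorphM mulVf ?gt_eqF// rmorph1 mulr1.
  rewrite mulrBr mulrA mulVf ?gt_eqF// mul1r expRD lnK ?posrE//.
  by rewrite expRN -mulrA /powR gt_eqF// mulVf ?mulr1// gt_eqF// expR_gt0.
Qed.

Lemma fhatZ c f a : bcfun f -> fhat (fun x => c * f x) a = c * fhat f a.
Proof.
move=> bf; rewrite /fhat -EcZ; last by apply: bcfunM => //; exact: bcfunJ.
by congr Ec; apply/funext => x; rewrite mulrA.
Qed.

Lemma rfejerZ c f x : bcfun f -> rfejer (fun y => c * f y) x = c * rfejer f x.
Proof.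
move=> bf; rewrite /rfejer mulr_sumr; apply: eq_bigr => a _.
by rewrite fhatZ//; ring.
Qed.

(** Letting [delta] tend to 0 gives [X ^ (1/s) <= X], and [1/s > 1] rules out [X > 1]. *)
Lemma le1_of_powR_fixed (X s : R) : 0 <= X -> 0 < s < 1 ->
  (forall delta, 0 < delta -> X <= (X + delta) `^ s) -> X <= 1.
Proof.
move=> X0 /andP[s0 s1] hX; rewrite leNgt; apply/negP => X1.
have : X `^ s^-1 <= X.
  apply/ler_addgt0Pr => delta d0.
  have Xd : 0 <= X + delta by rewrite addr_ge0// ltW.
  rewrite -[leRHS]powRr1// -(mulfV (lt0r_neq0 s0)) powRrM.
  by rewrite ge0_ler_powR ?invr_ge0 ?nnegrE ?powR_ge0 ?hX// ltW.
apply/negP; rewrite -ltNge.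
have -> : s^-1 = 1 + (s^-1 - 1) by ring.
rewrite powRD ?(gt_eqF (lt_trans ltr01 X1)) ?implybT//.
rewrite powRr1// -[ltLHS]mulr1 ltr_pM2l ?(lt_trans ltr01)//.
have : 1 `^ (s^-1 - 1) < X `^ (s^-1 - 1).
  by rewrite gt0_ltr_powR ?nnegrE// subr_gt0 invf_gt1.
by rewrite powR1.
Qed.

(** The point [(1/q, 1/r)] divides the segment from [(1/2, 1/2)] to [(0, 1/4)] in the ratio given by
    [th]. In place of a supremum over dual functions, [log_factor] is applied to the output as well.
    Pairing the output with its own dual power bounds its [r]-th moment [X] by
    [(X + eps) ^ (1 - 1/r)], and [le1_of_powR_fixed] concludes. *)
Lemma rfejer_LqLr f (j J : nat) (th := j%:R / J%:R : R)
    (q := 2 / (1 - th)) (r := 4 / (2 - th)) :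
  bcfun f -> (j < J)%N -> Er (fun x => normc (f x) `^ q) <= 1 ->
  Er (fun x => normc (rfejer f x) `^ r) <= 1.
Proof.
move=> bf jJ fq.
have J0 : (0 < J)%N by exact: leq_ltn_trans jJ.
have th0 : 0 <= th by rewrite divr_ge0.
have th1 : th < 1 by rewrite ltr_pdivrMr ?ltr0n// mul1r ltr_nat.
have q0 : 0 < q by rewrite divr_gt0// subr_gt0.
have qV : q^-1 = (1 - th) / 2 by rewrite invf_div.
have r0 : 0 < r by rewrite divr_gt0// subr_gt0 (lt_trans th1)// ltr1n.
have rV : r^-1 = (2 - th) / 4 by rewrite invf_div.
have r2 : 2 <= r.
  by rewrite -[leLHS]invrK -[leRHS]invrK lef_pV2 ?posrE ?invr_gt0// rV; lra.
apply/ler_addgt0Pr => delta d0.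
have [u [M [bu bM u1 EM fE]]] := log_factor bf q0 d0 fq.
set kp := _ `^ _ in fE.
have kp0 : 0 <= kp by exact: powR_ge0.
pose F s := u s * (expR ((1 - th) / 2 * M s))%:C.
have bF : bcfun F.
  apply: bcfunM => //; apply/bcfun_real/bfun_expR/bfunM => //; exact: bfun_cst.
have fF : f = fun s => kp%:C * F s.
  by apply/funext => s; rewrite fE /F -qV rmorphM; ring.
pose X := Er (fun x => normc (rfejer F x) `^ r).
have bG : bcfun (rfejer F) by exact: bcfun_rfejer.
have bGr : bfun (fun x => normc (rfejer F x) `^ r).
  by apply: bfun_powR => [|x|]; [exact: ltW|exact: normc_ge0|exact: bfun_normc].
have X0 : 0 <= X by apply: Er_ge0 => x; exact: powR_ge0.
have X1 : X <= 1.
  apply: (@le1_of_powR_fixed _ (1 - r^-1)) => //.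
    by rewrite rV; apply/andP; split; lra.
  move=> eps e_gt0.
  have [v [M' [bv bM' v1 EM' GE]]] := log_factor bG r0 e_gt0 (lexx X).
  set k := _ `^ _ in GE.
  have Xe0 : 0 < X + eps by rewrite ltr_wpDl.
  have k0 : 0 < k by exact: powR_gt0.
  have kr : k `^ r = X + eps by rewrite -powRrM mulVf ?gt_eqF// powRr1// ltW.
  have v1' x : normc (v x)^* <= 1 by rewrite normc_conj.
  have := exponential_interpolation bM bM' bu (bcfunJ bv) u1 v1' EM EM' J0 (ltnW jJ).
  rewrite -/th -/F => le1.
  have bvM : bfun (fun x => normc (v x) ^+ 2 * expR (M' x)).
    by apply: bfunM; [exact/bfunX/bfun_normc|exact: bfun_expR].
  have E1 : (fun t => (v t)^* * (expR ((2^-1 + th / 4) * M' t))%:C * rfejer F t) =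
      fun t => (k * (normc (v t) ^+ 2 * expR (M' t)))%:C.
    apply/funext => t; rewrite GE.
    have -> : expR (M' t) = expR ((2^-1 + th / 4) * M' t) * expR (r^-1 * M' t).
      by rewrite -expRD; congr expR; rewrite rV; field.
    have := sqr_normcE (v t); move: (normc (v t) ^+ 2) => n2 n2E.
    by rewrite !rmorphM/= n2E; ring.
  move: le1; rewrite E1 Ec_real normc_real => /(le_trans (ler_norm _)).
  rewrite ErZ// => le1.
  (* Here [|v| ^ r <= |v| ^ 2], because [|v| <= 1] and [r >= 2]; the pairing above controls the
     square. *)
  have : X <= (X + eps) * Er (fun x => normc (v x) ^+ 2 * expR (M' x)).
    rewrite /X -ErZ//; apply: Er_le => // [|x].
      by apply: bfunM => //; exact: bfun_cst.
    rewrite GE normcM normc_real ger0_norm ?mulr_ge0 ?expR_ge0 ?(ltW k0)//.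
    rewrite powRM ?normc_ge0 ?mulr_ge0 ?expR_ge0 ?(ltW k0)//.
    rewrite powRM ?expR_ge0 ?(ltW k0)// kr -expRM.
    rewrite mulrAC mulVf ?gt_eqF// mul1r.
    rewrite mulrA [leLHS]mulrC ler_wpM2l ?(ltW Xe0)//.
    rewrite ler_wpM2r ?expR_ge0//.
    have [->|v0] := eqVneq (normc (v x)) 0.
      by rewrite powR0 ?gt_eqF// sqr_ge0.
    by rewrite -powR_mulrn ?normc_ge0// ger_powR// lt_neqAle eq_sym v0 normc_ge0 v1.
  move=> /le_trans; apply.
  rewrite powRD ?(gt_eqF Xe0) ?implybT// powRr1 ?(ltW Xe0)// powRN -/k.
  by rewrite ler_pM2l// -[leRHS]mul1r ler_pdivlMr// mulrC.
have -> : (fun x => normc (rfejer f x) `^ r) =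
    fun x => kp `^ r * normc (rfejer F x) `^ r.
  apply/funext => x; rewrite fF rfejerZ// normcM normc_real ger0_norm//.
  by rewrite powRM// normc_ge0.
rewrite ErZ// -/X; apply: (@le_trans _ _ (kp `^ r)).
  by rewrite -[leRHS]mulr1 ler_wpM2l// powR_ge0.
(* The factor is [(1 + delta) ^ (r / q)], and [r <= q]. *)
rewrite /kp -powRrM; apply: ler1_powR; first by rewrite lerDl ltW.
rewrite qV mulrC /r mulf_div ler_pdivrMr ?mulr_gt0// ?subr_gt0 ?(lt_trans th1) ?ltr1n//.
by lra.
Qed.

End half_space.

(** * Composition of the projections in several variables *)

Variable dgs : nat -> I -> int.
Hypothesis dgsD : forall k a b, dgs k (a + b) = dgs k a + dgs k b.

Definition fejer_weights (S : seq I) (w : I -> R) := [/\ uniq S, 0 \in S,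
  forall a, 0 <= w a <= 1, w 0 = 1 & forall x y, exists r : R, 0 <= r /\
  \sum_(a <- S) (w a)%:C * (e a x * (e a y)^*) = r%:C].

Definition nneg_up_to k a := [forall i : 'I_k, 0 <= dgs i a].

Lemma nneg_up_toS k a :
  nneg_up_to k.+1 a = (0 <= dgs k a) && nneg_up_to k a.
Proof.
apply/forallP/andP => [h|[h /forallP h'] i].
  split; first by have := h ord_max.
  by apply/forallP => i; have := h (widen_ord (leqnSn k) i).
have := ltn_ord i; rewrite ltnS leq_eqVlt => /predU1P[->//|ik].
by have := h' (Ordinal ik).
Qed.

(* [1 / 2 - 1 / critical_pow k = 2 ^- k.+1], and the interpolated bound at
   [theta = 2 ^- k] halves this quantity. *)
Definition critical_pow k : R := 2 / (1 - 2^-1 ^+ k).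

Section weights.
Variables (S : seq I) (w : I -> R).
Hypothesis wS : fejer_weights S w.

(* The composition of [k] weighted one-variable projections applied to [f]; the
   weight is raised to the power [k]. *)
Definition riesz_chain f k x :=
  \sum_(a <- S | nneg_up_to k a) (w a ^+ k)%:C * fhat f a * e a x.

Lemma bcfun_riesz_chain f k : bcfun (riesz_chain f k).
Proof.
by rewrite /riesz_chain; under eq_fun do rewrite -big_filter; exact: bcfun_esum.
Qed.

Lemma fhat_riesz_chain f k a : fhat (riesz_chain f k) a =
  if nneg_up_to k a && (a \in S) then (w a ^+ k)%:C * fhat f a else 0.
Proof.
case: wS => uS _ _ _ _.
rewrite /riesz_chain; under eq_fun do rewrite -big_filter.
by rewrite fhat_sum ?filter_uniq// mem_filter.
Qed.

Lemma riesz_chainS f k :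
  rfejer (dgs k) S w (riesz_chain f k) = riesz_chain f k.+1.
Proof.
apply/funext => x; rewrite /riesz_chain /rfejer -/(riesz_chain f k).
rewrite [RHS](eq_bigl (fun a => (0 <= dgs k a) && nneg_up_to k a)) => [|a]; last first.
  by rewrite nneg_up_toS.
rewrite [RHS]big_mkcondr/= [LHS]big_seq_cond [RHS]big_seq_cond.
apply: eq_bigr => a /andP[aS _].
rewrite fhat_riesz_chain aS andbT; case: ifP => _.
  by rewrite exprS rmorphM/= !mulrA.
by rewrite mulr0 mul0r.
Qed.

(** The induction starts from one projection, where [critical_pow 1 = 4] is the endpoint
    [L^oo -> L^4]; [critical_pow 0] should be infinite but is 0 by the convention on division. The
    step is [rfejer_LqLr] at [th = 2 ^- k.+1], which sends [critical_pow k.+1] to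
    [critical_pow k.+2]. *)
Lemma riesz_chain_critical f k : bcfun f -> (forall x, normc (f x) <= 1) ->
  Er (fun x => normc (riesz_chain f k.+1 x) `^ critical_pow k.+1) <= 1.
Proof.
move=> bf f1; have [uS S0 w01 w0 ker] := wS.
elim: k => [|k IH].
  have -> : critical_pow 1 = 4%:R by rewrite /critical_pow; field.
  under eq_fun do rewrite powR_mulrn ?normc_ge0//.
  have -> : riesz_chain f 1 = rfejer (dgs 0%N) S w f.
    rewrite /riesz_chain /rfejer; apply/funext => x.
    apply: eq_big => [a|a _]; last by rewrite expr1.
    have n0 : nneg_up_to 0 a by apply/forallP => -[].
    by rewrite (nneg_up_toS 0) n0 andbT.
  exact: (rfejer_L4 (dgsD 0)).
rewrite -riesz_chainS.
have := @rfejer_LqLr _ (dgsD k.+1) _ _ uS S0 w01 w0 ker (riesz_chain f k.+1)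
  1 (2 ^ k.+1) (bcfun_riesz_chain f k.+1).
have -> : 1%:R / (2 ^ k.+1)%:R = 2^-1 ^+ k.+1 :> R.
  by rewrite natrX exprVn mul1r.
have -> : 4 / (2 - 2^-1 ^+ k.+1) = critical_pow k.+2.
  rewrite /critical_pow [2^-1 ^+ k.+2]exprS; set z := _ ^+ _.
  have z1 : z < 2.
    by rewrite (@le_lt_trans _ _ 1) ?ltr1n// exprn_ile1// invf_le1// ler1n.
  by field; rewrite subr_eq0 gt_eqF.
by apply => //; exact: (@ltn_exp2l 2 0 k.+1).
Qed.

End weights.

(** * Removal of the weights in the limit *)

Lemma onem_exprn_le (x : R) n : 0 <= x <= 1 -> 1 - x ^+ n <= n%:R * (1 - x).
Proof.
move=> /andP[x0 x1]; elim: n => [|n IH]; first by rewrite expr0 subrr mul0r.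
have xn0 : 0 <= x ^+ n by exact: exprn_ge0.
have xn1 : x ^+ n <= 1 by exact: exprn_ile1.
have : x ^+ n * (1 - x) <= 1 * (1 - x) by rewrite ler_wpM2r// subr_ge0.
rewrite exprS -natr1; lra.
Qed.

Lemma ler_sum_subset (A B : seq I) (F : I -> R) : uniq A -> uniq B ->
  {subset A <= B} -> (forall a, 0 <= F a) ->
  \sum_(a <- A) F a <= \sum_(a <- B) F a.
Proof.
move=> uA uB AB F0.
have -> : \sum_(a <- A) F a = \sum_(a <- B | a \in A) F a.
  rewrite -[RHS]big_filter; apply: perm_big; apply: uniq_perm => //.
    exact: filter_uniq.
  by move=> a; rewrite mem_filter andb_idr//; exact: AB.
rewrite [leRHS](bigID (mem A))/= lerDl.
by apply: sumr_ge0 => a _.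
Qed.

Lemma normc_fhat_le1 f a : bcfun f -> (forall x, normc (f x) <= 1) ->
  normc (fhat f a) <= 1.
Proof.
move=> bf f1.
have := bessel (s := [:: a]) bf isT.
rewrite big_seq1 => h.
have : Er (fun x => normc (f x) ^+ 2) <= 1.
  rewrite -[leRHS](Er_cst P); apply: Er_le => [||x].
  - exact/bfunX/bfun_normc.
  - exact: bfun_cst.
  - by rewrite exprn_ile1 ?normc_ge0.
move=> /(le_trans h); rewrite -[leRHS](expr1n _ 2).
by rewrite ler_sqr ?nnegrE ?normc_ge0.
Qed.

(** The pointwise bound [X <= X ^ 2 / (2 eps) + eps / 2] serves in place of the Cauchy-Schwarz
    inequality for integrals. *)
Lemma Er_le_sqr (X : T -> R) (eps K : R) : 0 < eps -> bfun X ->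
  Er (fun x => X x ^+ 2) <= K * eps ^+ 2 -> Er X <= (K + 1) / 2 * eps.
Proof.
move=> eps0 bX X2.
have : Er X <= Er (fun x => (2 * eps)^-1 * X x ^+ 2 + eps / 2).
  apply: Er_le => // [|x].
    apply: bfunD; last exact: bfun_cst.
    by apply: bfunM; [exact: bfun_cst|exact: bfunX].
  rewrite -(ler_pM2l (mulr_gt0 (ltr0n R 2) eps0)) mulrDr mulrA.
  rewrite mulfV ?gt_eqF ?mulr_gt0// mul1r.
  by have := sqr_ge0 (X x - eps); lra.
rewrite ErD; last 2 first.
- by apply: bfunM; [exact: bfun_cst|exact: bfunX].
- exact: bfun_cst.
rewrite Er_cst ErZ; last exact: bfunX.
move=> /le_trans; apply.
have : (2 * eps)^-1 * Er (fun x => X x ^+ 2) <= (2 * eps)^-1 * (K * eps ^+ 2).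
  by rewrite ler_pM2l// invr_gt0 mulr_gt0.
have -> : (2 * eps)^-1 * (K * eps ^+ 2) = K / 2 * eps by field; rewrite gt_eqF.
lra.
Qed.

Definition riesz_partial f n (A : seq I) x :=
  \sum_(a <- A | nneg_up_to n a) fhat f a * e a x.

Hypothesis approx_weights : forall (A : seq I) (eps : R), 0 < eps ->
  exists S w, [/\ fejer_weights S w, {subset A <= S} &
                  forall a, a \in A -> 1 - eps <= w a].

(** By orthogonality the error is the sum of [(1 - w ^ n) ^ 2 |fhat f a| ^ 2]. Bessel's inequality
    bounds the energy of finite sets, so some finite [B] carries all but [eps ^ 2] of the supremum.
    On [B] the weights are close to 1, and outside the coefficients are small; each part contributes
    at most [eps ^ 2]. *)
Lemma riesz_approx f n (A : seq I) eps : bcfun f -> (forall x, normc (f x) <= 1) ->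
  0 < eps -> exists S w, [/\ fejer_weights S w, {subset A <= S} &
    Er (fun x => normc (riesz_partial f n S x - riesz_chain S w f n x) ^+ 2)
      <= 2 * eps ^+ 2].
Proof.
move=> bf f1 eps0.
pose F a := normc (fhat f a) ^+ 2.
have F0 a : 0 <= F a by exact: sqr_ge0.
have F1 a : F a <= 1.
  by rewrite exprn_ile1 ?normc_ge0//; exact: normc_fhat_le1.
pose E := [set x | exists s : seq I, uniq s /\ x = \sum_(a <- s) F a].
have Eub s : uniq s -> \sum_(a <- s) F a <= sup E.
  move=> us; apply: ub_le_sup; last by exists s.
  exists (Er (fun x => normc (f x) ^+ 2)) => _ [s' [us' ->]].
  exact: bessel.
have supE : has_sup E.
  split; first by exists (\sum_(a <- [::]) F a), [::].
  exists (Er (fun x => normc (f x) ^+ 2)) => _ [s' [us' ->]].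
  exact: bessel.
have eps2 : 0 < eps ^+ 2 by exact: exprn_gt0.
have [_ [A1 [uA1 ->]] A1P] := sup_adherent eps2 supE.
pose B := undup (A ++ A1).
have uB : uniq B by exact: undup_uniq.
(* Each index of [B] contributes at most [n * del], so all of them stay below [eps ^ 2]; the added 1
   keeps the denominator positive. *)
pose del := eps ^+ 2 / (n%:R * (size B)%:R + 1).
have den0 : 0 < n%:R * (size B)%:R + 1 :> R by rewrite ltr_wpDl// mulr_ge0.
have del0 : 0 < del by rewrite divr_gt0.
have [S [w [wS BS wB]]] := approx_weights B del0.
exists S, w; split=> //.
  by move=> a aA; apply: BS; rewrite mem_undup mem_cat aA.
have [uS _ w01 _ _] := wS.
have -> : (fun x => normc (riesz_partial f n S x - riesz_chain S w f n x) ^+ 2) =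
    fun x => normc (\sum_(a <- [seq a <- S | nneg_up_to n a])
      ((1 - w a ^+ n)%:C * fhat f a) * e a x) ^+ 2.
  apply/funext => x; congr (normc _ ^+ 2).
  rewrite big_filter -sumrB; apply: eq_bigr => a _.
  by rewrite rmorphB rmorph1; ring.
rewrite Er_sqr_normc_sum ?filter_uniq// big_filter.
have om01 a : 0 <= 1 - w a ^+ n <= 1.
  have /andP[w0 w1] := w01 a.
  by rewrite subr_ge0 exprn_ile1//= gerBl exprn_ge0.
have termE a : normc ((1 - w a ^+ n)%:C * fhat f a) ^+ 2 =
    (1 - w a ^+ n) ^+ 2 * F a.
  by rewrite normcM exprMn normc_real ger0_norm//; case/andP: (om01 a).
rewrite (eq_bigr _ (fun a _ => termE a)).
have sq1 a : (1 - w a ^+ n) ^+ 2 <= 1 - w a ^+ n.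
  by have /andP[q0 q1] := om01 a; rewrite expr2 ler_piMl.
apply: (@le_trans _ _ (\sum_(a <- S) (1 - w a ^+ n) ^+ 2 * F a)).
  rewrite [leRHS](bigID (nneg_up_to n))/= lerDl.
  by apply: sumr_ge0 => a _; rewrite mulr_ge0// sqr_ge0.
rewrite (bigID (mem B))/= mulr_natl mulr2n; apply: lerD.
  have -> : \sum_(a <- S | a \in B) (1 - w a ^+ n) ^+ 2 * F a =
      \sum_(a <- B) (1 - w a ^+ n) ^+ 2 * F a.
    rewrite -[LHS]big_filter; apply: perm_big; apply: uniq_perm => //.
      exact: filter_uniq.
    by move=> a; rewrite mem_filter andb_idr//; exact: BS.
  apply: (@le_trans _ _ (\sum_(a <- B) n%:R * del)).
    rewrite big_seq [leRHS]big_seq; apply: ler_sum => a aB.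
    apply: (@le_trans _ _ (1 - w a ^+ n)).
      by rewrite -[leRHS]mulr1 ler_pM ?sqr_ge0.
    apply: le_trans (onem_exprn_le n (w01 a)) _.
    by rewrite ler_wpM2l//; have := wB _ aB; lra.
  rewrite big_const_seq count_predT iter_addr_0 -[leLHS]mulr_natr /del.
  have -> : n%:R * (eps ^+ 2 / (n%:R * (size B)%:R + 1)) * (size B)%:R =
      eps ^+ 2 * (n%:R * (size B)%:R) / (n%:R * (size B)%:R + 1) by ring.
  by rewrite ler_pdivrMr// ler_pM2l// lerDl.
apply: (@le_trans _ _ (\sum_(a <- S | a \notin B) F a)).
  apply: ler_sum => a _; rewrite -[leRHS]mul1r ler_wpM2r//.
  by rewrite (le_trans (sq1 a))//; case/andP: (om01 a).
have h1 : \sum_(a <- S) F a = \sum_(a <- S | a \in B) F a + \sum_(a <- S | a \notin B) F a.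
  by rewrite (bigID (mem B)).
have h2 : \sum_(a <- A1) F a <= \sum_(a <- S | a \in B) F a.
  rewrite -[leRHS]big_filter; apply: ler_sum_subset => //; first exact: filter_uniq.
  move=> a aA1; have aB : a \in B by rewrite mem_undup mem_cat aA1 orbT.
  by rewrite mem_filter aB BS.
have := Eub S uS; rewrite h1; lra.
Qed.

(** The approximation of [g] is only in the mean square, while the bound sought is of order [p > 2].
    Truncating at [M] bridges the gap: below this height an error of small mean changes the [p]-th
    moment by at most [p M ^ (p - 1)] times that mean. *)
Lemma riesz_limit_critical (f g : T -> R[i]) n (M : R) : bcfun f -> (forall x, normc (f x) <= 1) ->
  measurable_fun setT (fun x => complex.Re (g x)) ->
  measurable_fun setT (fun x => complex.Im (g x)) -> 0 <= M ->
  (forall eps, 0 < eps -> exists A0 : seq I, forall A, uniq A -> {subset A0 <= A} ->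
    Er (fun x => Num.min (normc (g x - riesz_partial f n.+1 A x)) M ^+ 2) <= eps ^+ 2) ->
  Er (fun x => Num.min (normc (g x)) M `^ critical_pow n.+1) <= 1.
Proof.
move=> bf f1 mgr mgi M0 gA; set p := critical_pow _.
have p1 : 1 < p.
  rewrite /p /critical_pow ltr_pdivlMr.
    by rewrite mul1r (@lt_le_trans _ _ 1) ?ler1n// gtrBl exprn_gt0.
  by rewrite subr_gt0 exprn_ilt1// invf_lt1// ltr1n.
have p0 : 0 < p by exact: lt_trans p1.
have bmin (h : T -> R[i]) : measurable_fun setT (fun x => complex.Re (h x)) ->
    measurable_fun setT (fun x => complex.Im (h x)) ->
    bfun (fun x => Num.min (normc (h x)) M).
  move=> mr mi; split.
    apply: measurable_minr => //.
    have -> : (fun x => normc (h x)) = Num.sqrt \o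
        (fun x => complex.Re (h x) ^+ 2 + complex.Im (h x) ^+ 2).
      by apply/funext => x /=; case: (h x).
    apply: measurableT_comp; first by apply: continuous_measurable_fun; exact: sqrt_continuous.
    by apply: measurable_funD; exact: measurable_funX.
  exists M => x; rewrite ger0_norm ?ge_min ?lexx ?orbT//.
  by rewrite le_min normc_ge0.
pose s x := Num.min (normc (g x)) M.
have bs : bfun s by exact: bmin.
have s0 x : 0 <= s x by rewrite le_min normc_ge0.
have sM x : s x <= M by rewrite ge_min lexx orbT.
have bsp : bfun (fun x => s x `^ p) by apply: bfun_powR => //; exact: ltW.
apply/ler_addgt0Pr => del del0.
(* The two errors have means at most [eps] and [3/2 * eps], together below [3 * eps]; the added 1
   makes [K] positive. *)
pose K := p * M `^ (p - 1) * 3 + 1.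
have K0 : 0 < K.
  rewrite /K; apply: ltr_wpDl => //.
  by apply: mulr_ge0 => //; exact: mulr_ge0 (ltW p0) (powR_ge0 _ _).
pose eps := del / K; have eps0 : 0 < eps by exact: divr_gt0.
have [A0 A0P] := gA _ eps0.
have [S [w [wS A0S SG]]] := riesz_approx n.+1 A0 bf f1 eps0.
have [uS _ _ _ _] := wS.
pose G := riesz_chain S w f n.+1.
pose Pt := riesz_partial f n.+1 S.
have bG : bcfun G by exact: bcfun_riesz_chain.
have bPt : bcfun Pt.
  by rewrite /Pt /riesz_partial; under eq_fun do rewrite -big_filter; exact: bcfun_esum.
pose D x := Num.min (normc (g x - Pt x)) M.
have bD : bfun D.
  have [[mr _] [mi _]] := bPt.
  by apply: bmin; under eq_fun do rewrite !cReImE; exact: measurable_funB.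
pose H x := normc (Pt x - G x).
have bH : bfun H by apply: bfun_normc; exact: bcfunB.
have ED : Er D <= (1 + 1) / 2 * eps.
  by apply: Er_le_sqr => //; rewrite mul1r; exact: A0P.
have EH : Er H <= (2 + 1) / 2 * eps by apply: Er_le_sqr.
have bGp : bfun (fun x => normc (G x) `^ p).
  by apply: bfun_powR => [|x|]; [exact: ltW|exact: normc_ge0|exact: bfun_normc].
have EG : Er (fun x => normc (G x) `^ p) <= 1 by exact: riesz_chain_critical.
have sle x : s x <= normc (G x) + (D x + H x).
  have t1 : normc (g x) <= normc (g x - Pt x) + H x + normc (G x).
    have -> : g x = (g x - Pt x) + (Pt x - G x) + G x by ring.
    apply: le_trans (le_normcD _ _) _; rewrite lerD2r.
    have -> : g x - Pt x + (Pt x - G x) + G x - Pt x = g x - Pt x by ring.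
    exact: le_normcD.
  have H0 : 0 <= H x by exact: normc_ge0.
  have G0 : 0 <= normc (G x) by exact: normc_ge0.
  have sg : s x <= normc (g x) by rewrite ge_min lexx.
  by have := sM x; rewrite /D {1}/Num.min; case: ifP => _; lra.
(* Write [s ^ p = s * s ^ (p - 1)], insert [sle], and bound [|G| * s ^ (p - 1)] by Young's
   inequality with exponents [p] and [p / (p - 1)]. The resulting [(p - 1) / p] share of [s ^ p] is
   absorbed on the left. *)
have main x : s x `^ p <= normc (G x) `^ p + p * M `^ (p - 1) * (D x + H x).
  have D0 : 0 <= D x by rewrite le_min normc_ge0.
  have DH0 : 0 <= D x + H x by rewrite addr_ge0 ?normc_ge0.
  have spE : s x * s x `^ (p - 1) = s x `^ p by rewrite mulr_powRB1.
  have sp1 : s x `^ (p - 1) <= M `^ (p - 1).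
    by rewrite ge0_ler_powR ?nnegrE// subr_ge0 ltW.
  have : s x `^ p <= (normc (G x) + (D x + H x)) * s x `^ (p - 1).
    by rewrite -spE ler_wpM2r// powR_ge0.
  have young : normc (G x) * s x `^ (p - 1) <=
      normc (G x) `^ p / p + (s x `^ (p - 1)) `^ (p / (p - 1)) / (p / (p - 1)).
    apply: conjugate_powR; rewrite ?normc_ge0 ?powR_ge0//.
      by rewrite divr_gt0// subr_gt0.
    by field; rewrite ?subr_eq0 ?(gt_eqF p0) ?(gt_eqF p1).
  have := ler_wpM2l DH0 sp1.
  rewrite -powRrM in young.
  have pE : (p - 1) * (p / (p - 1)) = p by field; rewrite ?subr_eq0 ?(gt_eqF p0) ?(gt_eqF p1).
  rewrite {}pE in young.
  move: young; move: (s x `^ p) (normc (G x) `^ p) => a b young h1 h2.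
  have young' : p * (normc (G x) * s x `^ (p - 1)) <= b + (p - 1) * a.
    have -> : b + (p - 1) * a = p * (b / p + a / (p / (p - 1))).
      by field; rewrite ?subr_eq0 ?(gt_eqF p0) ?(gt_eqF p1).
    by rewrite ler_pM2l.
  have h3 : p * a <= p * ((normc (G x) + (D x + H x)) * s x `^ (p - 1)).
    by rewrite ler_pM2l.
  have h4 : p * ((D x + H x) * s x `^ (p - 1)) <= p * ((D x + H x) * M `^ (p - 1)).
    by rewrite ler_pM2l.
  lra.
have bDH : bfun (fun x => p * M `^ (p - 1) * (D x + H x)).
  by apply: bfunM; [exact: bfun_cst|exact: bfunD].
have := Er_le P bsp (bfunD bGp bDH) main.
rewrite ErD// ErZ; last exact: bfunD.
rewrite ErD// => /le_trans; apply.
rewrite lerD//; apply: (@le_trans _ _ (p * M `^ (p - 1) * (3 * eps))).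
  apply: ler_wpM2l; first exact: mulr_ge0 (ltW p0) (powR_ge0 _ _).
  by apply: le_trans (lerD ED EH) _; lra.
have -> : del = K * eps by rewrite /eps mulrC divfK// gt_eqF.
rewrite mulrA ler_wpM2r ?(ltW eps0)// /K; lra.
Qed.

End characters.

(** * Characters of the torus *)

Section circle_expectation.
Variable R : realType.
Local Notation U := (uniform_prob (@pi2_gt0 R)).

Lemma Er_uniform (f F : R -> R) : bfun f -> (forall x, 0 <= f x) -> continuous f ->
  (forall x : R, is_derive x 1 F (f x)) ->
  Er U f = (F (2 * pi) - F 0) / (2 * pi).
Proof.
move=> bf f0 cf dF.
have [mf _] := bf.
apply: EFin_inj; rewrite EFin_Er// integral_uniform//; last exact/measurable_EFinP.
have dvF x : derivable F x 1 by case: (dF x).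
have cF x : {for x, continuous F}.
  by apply/differentiable_continuous/derivable1_diffP; exact: dvF.
rewrite (@continuous_FTC2 _ f F).
- by rewrite subr0 -EFinB -EFinM mulrC.
- by rewrite mulr_gt0// pi_gt0.
- exact: continuous_subspaceT.
- split => //.
  + by apply: cvg_at_right_filter; exact: cF.
  + by apply: cvg_at_left_filter; exact: cF.
- by move=> x _; rewrite derive1E; exact: derive_val.
Qed.

Lemma is_derive_scale (k x : R) : is_derive x 1 ( *%R k) k.
Proof.
have := @is_deriveZ R R _ id k x 1 1 (is_derive_id x 1).
by rewrite [k *: 1]mulr1.
Qed.

Lemma bfun_scale_comp (k : R) (g : R -> R) : continuous g ->
  (exists M, forall x, `|g x| <= M) -> bfun (fun t : measurableTypeR R => g (k * t)).
Proof.
move=> cg [M gM]; split; last by exists M.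
apply: continuous_measurable_fun => x.
by apply: continuous_comp; [exact: mulrl_continuous|exact: cg].
Qed.

Lemma Er_cos_nat (j : nat) : Er U (fun t => cos (j.+1%:R * t)) = 0.
Proof.
have j0 : j.+1%:R != 0 :> R by rewrite pnatr_eq0.
have bc : bfun (fun t : measurableTypeR R => cos (j.+1%:R * t)).
  apply: bfun_scale_comp; first exact: continuous_cos.
  by exists 1; exact: cos_max.
(* [Er_uniform] takes nonnegative integrands, so the constant 1 is added here and cancelled
   afterwards. *)
have := @Er_uniform (fun t => 1 + cos (j.+1%:R * t))
  (fun t => t + j.+1%:R^-1 * sin (j.+1%:R * t)).
rewrite ErD//; last exact: bfun_cst.
rewrite Er_cst mulr0 sin0 mulr0 addr0 subr0.
have -> : sin (j.+1%:R * (2 * pi)) = 0 :> R.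
  have -> : j.+1%:R * (2 * pi) = 0 + (pi *+ 2) *+ j.+1 :> R.
    by rewrite add0r -(mulr_natl (pi *+ 2)) -(mulr_natl pi).
  by rewrite (periodicn (@sinD2pi R)) sin0.
rewrite mulr0 addr0 divff ?gt_eqF ?mulr_gt0 ?pi_gt0//.
move=> h; apply: (addrI 1); rewrite addr0; apply: h.
- by apply: bfunD => //; exact: bfun_cst.
- by move=> x; have := cos_geN1 (j.+1%:R * x); lra.
- move=> x; apply: cvgD; first exact: cvg_cst.
  by apply: continuous_comp; [exact: mulrl_continuous|exact: continuous_cos].
- move=> x; apply: is_deriveD.
  have := is_deriveZ j.+1%:R^-1 (is_derive1_comp (is_derive_sin _) (is_derive_scale j.+1%:R x)).
  by rewrite [_ *: _]mulrCA mulVf// mulr1.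
Qed.

Lemma Er_sin_nat (j : nat) : Er U (fun t => sin (j.+1%:R * t)) = 0.
Proof.
have j0 : j.+1%:R != 0 :> R by rewrite pnatr_eq0.
have bc : bfun (fun t : measurableTypeR R => sin (j.+1%:R * t)).
  apply: bfun_scale_comp; first exact: continuous_sin.
  by exists 1; exact: sin_max.
have := @Er_uniform (fun t => 1 + sin (j.+1%:R * t))
  (fun t => t + - j.+1%:R^-1 * cos (j.+1%:R * t)).
rewrite ErD//; last exact: bfun_cst.
rewrite Er_cst mulr0.
have -> : cos (j.+1%:R * (2 * pi)) = cos 0 :> R.
  have -> : j.+1%:R * (2 * pi) = 0 + (pi *+ 2) *+ j.+1 :> R.
    by rewrite add0r -(mulr_natl (pi *+ 2)) -(mulr_natl pi).
  by rewrite (periodicn (@cosD2pi R)).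
rewrite opprD addrACA subrr addr0 subr0 divff ?gt_eqF ?mulr_gt0 ?pi_gt0//.
move=> h; apply: (addrI 1); rewrite addr0; apply: h.
- by apply: bfunD => //; exact: bfun_cst.
- by move=> x; have := sin_geN1 (j.+1%:R * x); lra.
- move=> x; apply: cvgD; first exact: cvg_cst.
  by apply: continuous_comp; [exact: mulrl_continuous|exact: continuous_sin].
- move=> x; apply: is_deriveD.
  have := is_deriveZ (- j.+1%:R^-1) (is_derive1_comp (is_derive_cos _) (is_derive_scale j.+1%:R x)).
  by rewrite [_ *: _](_ : _ = sin (j.+1%:R * x)) //; rewrite /GRing.scale/=; field.
Qed.

Lemma normc_circle (z : circle R) : normc (val z) = 1.
Proof.
case: z => z /= /eqP z1; apply: (@complexI R).
by have : `|z| = 1 by []; case: z z1.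
Qed.

Lemma invc_circle (z : circle R) : (val z)^-1 = (val z)^*.
Proof.
have z1 := mulcJ_of_normc1 (normc_circle z).
have z0 : val z != 0.
  by apply: contra_eq_neq z1 => ->; rewrite mul0r eq_sym oner_eq0.
by apply: (mulfI z0); rewrite z1 mulfV.
Qed.

Lemma measurable_circle_coords : measurable_fun setT (@circle_coords R).
Proof. by move=> _ B mB; rewrite setTI; exists B => //; rewrite setTI. Qed.

Lemma bcfun_val : bcfun (fun z : circle R => val z).
Proof.
have [m1 m2] := (measurable_fun_pairP _).1 measurable_circle_coords.
apply: bcfunE; [exact: m1|exact: m2|].
by exists 1 => z; rewrite normc_circle.
Qed.

Lemma bcfun_exprz (k : int) : bcfun (fun z : circle R => val z ^ k).
Proof.
case: k => k; first by apply: bcfunX; exact: bcfun_val.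
under eq_fun do rewrite NegzE -exprz_inv invc_circle.
by apply: bcfunX; apply: bcfunJ; exact: bcfun_val.
Qed.

Lemma expi_exprn (t : R) (n : nat) : val (expi t) ^+ n = cis (n%:R * t).
Proof.
elim: n => [|n IH]; first by rewrite expr0 mul0r cis0.
by rewrite exprS IH -natr1 mulrDl mul1r addrC cisD.
Qed.

Lemma Ec_circle_exprz (k : int) :
  Ec (circle_measure R) (fun z => val z ^ k) = (k == 0)%:R.
Proof.
have pos (j : nat) : Ec (circle_measure R) (fun z => val z ^+ j.+1) = 0.
  rewrite Ec_distribution; last by apply: bcfunX; exact: bcfun_val.
  under eq_fun do rewrite expi_exprn.
  by apply: complexP; rewrite /= ?Er_cos_nat ?Er_sin_nat.
case: k => [[|j]|j].
- by rewrite eqxx -[RHS](Ec_cst (circle_measure R)).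
- exact: pos.
- rewrite (_ : (fun z => _) = fun z : circle R => (val z ^+ j.+1)^*); last first.
    by apply/funext => z; rewrite NegzE -exprz_inv invc_circle rmorphXn.
  by rewrite EcJ ?pos ?conjc0//; apply: bcfunX; exact: bcfun_val.
Qed.

End circle_expectation.

Section torus_expectation.
Variable R : realType.

Lemma bcfun_prod d (T : measurableType d) (I : Type) (s : seq I) (F : I -> T -> R[i]) :
  (forall i, bcfun (F i)) -> bcfun (fun x => \prod_(i <- s) F i x).
Proof.
move=> bF; elim: s => [|i s IH].
  by under eq_fun do rewrite big_nil; exact: bcfun_cst.
by under eq_fun do rewrite big_cons; exact: bcfunM.
Qed.

Lemma bcfun_tnth n (i : 'I_n) (f : circle R -> R[i]) : bcfun f ->
  bcfun (fun z : torus R n => f (tnth z i)).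
Proof.
move=> [[mr [M rM]] [mi [N iN]]].
split; split; [|by exists M|  |by exists N].
- exact: (measurableT_comp mr (measurable_tnth i)).
- exact: (measurableT_comp mi (measurable_tnth i)).
Qed.

Lemma bcfun_monomial n (a : {ffun 'I_n -> int}) : bcfun (monomial a : torus R n -> R[i]).
Proof.
apply: bcfun_prod => i.
exact: (bcfun_tnth i (bcfun_exprz R (a i))).
Qed.

Lemma val_neq0 (z : circle R) : val z != 0.
Proof.
apply/eqP => z0; have := normc_circle z; rewrite z0 normc0 => /eqP.
by rewrite eq_sym oner_eq0.
Qed.

Lemma monomialD n (a b : {ffun 'I_n -> int}) (z : torus R n) :
  monomial (a + b) z = monomial a z * monomial b z.
Proof.
rewrite /monomial -big_split/=; apply: eq_bigr => i _.
by rewrite ffunE expfzDr// val_neq0.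
Qed.

Lemma monomialN n (a : {ffun 'I_n -> int}) (z : torus R n) :
  monomial (- a) z = (monomial a z)^*.
Proof.
rewrite /monomial rmorph_prod; apply: eq_bigr => i _.
rewrite ffunE -exprz_inv invc_circle.
by case: (a i) => k; rewrite ?NegzE -?exprnN ?conjc_inv -?exprnP ?rmorphXn//= -rmorphXn conjc_inv.
Qed.

Lemma monomial0 n (z : torus R n) : monomial 0 z = 1.
Proof. by rewrite /monomial big1// => i _; rewrite ffunE expr0z. Qed.

Lemma Ec_monomial n (a : {ffun 'I_n -> int}) :
  Ec (torus_measure R n) (monomial a) = (a == 0)%:R.
Proof.
elim: n a => [|n IH] a.
  have -> : a = 0 by apply/ffunP => -[].
  rewrite eqxx -[RHS](Ec_cst (torus_measure R 0)); congr Ec.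
  by apply/funext => z; rewrite monomial0.
pose a' := [ffun i : 'I_n => a (lift ord0 i)].
rewrite Ec_distribution; last exact: bcfun_monomial.
have -> : (fun z => monomial a (torus_cons z)) =
    (fun z : circle R * torus R n => val z.1 ^ a ord0 * monomial a' z.2).
  apply/funext => z; rewrite /monomial big_ord_recl; congr (_ * _).
  apply: eq_bigr => i _; rewrite ffunE; congr (val _ ^ _).
  by rewrite /torus_cons/= tnthS.
rewrite (Ec_prod (circle_measure R) (torus_measure R n)
  (bcfun_exprz R (a ord0)) (bcfun_monomial a')).
rewrite Ec_circle_exprz IH -natrM mulnb; congr (nat_of_bool _)%:R.
apply/andP/eqP => [[/eqP h0 /eqP h]|a0].
  apply/ffunP => i; rewrite ffunE.
  have [j ->|->//] := unliftP ord0 i.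
  by have := congr1 (fun f : {ffun _} => f j) h; rewrite !ffunE.
by split; [rewrite a0 ffunE|apply/eqP/ffunP => i; rewrite !ffunE a0 ffunE].
Qed.

End torus_expectation.

(** * Fejer weights *)

Section fejer_kernel.
Variable R : realType.
Implicit Types (v : R[i]) (N : nat).

Lemma sum_circle_rev v N : normc v = 1 ->
  (\sum_(m < N) v ^+ m)^* * v ^+ N = \sum_(m < N) v ^+ m.+1.
Proof.
move=> v1; rewrite rmorph_sum mulr_suml (reindex_inj rev_ord_inj)/=.
apply: eq_bigr => m _.
rewrite -[in v ^+ N](subnK (ltn_ord m)) exprD mulrA rmorphXn/= -exprMn.
by rewrite [_ * v]mulrC mulcJ_of_normc1// expr1n mul1r.
Qed.

(** Fejer's identity, the sum of [(N - |k|) v ^ k] being a squared modulus. When [N] grows by one,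
    both sides gain the sum of all [v ^ k] with [|k| <= N]; on the right these are the cross terms
    of the new summand, reordered by [sum_circle_rev]. *)
Lemma fejer_kernel1 v N : normc v = 1 ->
  \sum_(m < N) (N - m)%:R * v ^+ m + \sum_(m < N) (N - m.+1)%:R * v^* ^+ m.+1 =
  (normc (\sum_(m < N) v ^+ m) ^+ 2)%:C.
Proof.
move=> v1; rewrite sqr_normcE.
elim: N => [|N IH]; first by rewrite !big_ord0 mul0r addr0.
have stepl (x : R[i]) : \sum_(m < N.+1) (N.+1 - m)%:R * x ^+ m =
    \sum_(m < N) (N - m)%:R * x ^+ m + \sum_(m < N.+1) x ^+ m.
  rewrite !big_ord_recr/= subSnn mul1r addrA; congr (_ + _).
  rewrite -big_split; apply: eq_bigr => m _ /=.
  by rewrite subSn ?(ltnW (ltn_ord m))// -natr1 mulrDl mul1r.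
have stepr (x : R[i]) : \sum_(m < N.+1) (N.+1 - m.+1)%:R * x ^+ m.+1 =
    \sum_(m < N) (N - m.+1)%:R * x ^+ m.+1 + \sum_(m < N) x ^+ m.+1.
  rewrite big_ord_recr/= subnn mul0r addr0 -big_split; apply: eq_bigr => m _ /=.
  by rewrite subSS -(subnSK (ltn_ord m)) -natr1 mulrDl mul1r.
rewrite stepl stepr addrACA IH.
have r1 := sum_circle_rev N v1.
have r2 : (\sum_(m < N) v ^+ m) * v^* ^+ N = \sum_(m < N) v^* ^+ m.+1.
  have -> : \sum_(m < N) v ^+ m = (\sum_(m < N) v^* ^+ m)^*.
    by rewrite rmorph_sum; apply: eq_bigr => m _; rewrite rmorphXn/= conjcK.
  by apply: sum_circle_rev; rewrite normc_conj.
rewrite [in RHS]big_ord_recr/= rmorphD rmorphXn/= mulrDl !mulrDr r2.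
have r3 : v ^+ N * v^* ^+ N = 1 by rewrite -exprMn mulcJ_of_normc1// expr1n.
rewrite r3 [v ^+ N * _]mulrC r1 -addrA; congr (_ + _).
rewrite big_ord_recl expr0 addrC; congr (_ + _).
by rewrite addrC.
Qed.

Definition triangle N (k : int) : R := Num.max 0 (1 - `|k|%N%:R / N%:R).

(* [inl m] encodes [m] and [inr m] encodes [- m.+1], so that the range is the
   interval from [- N] to [N - 1]; the weight of [- N] vanishes. *)
Definition box_int N (k : 'I_N + 'I_N) : int :=
  match k with inl m => Posz m | inr m => Negz m end.

Lemma box_int_inj N : injective (@box_int N).
Proof. by move=> [m|m] [m'|m'] //= [] /ord_inj ->. Qed.

Lemma fejer_kernel_ge0 v N : (0 < N)%N -> normc v = 1 -> exists r : R, 0 <= r /\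
  \sum_(k : 'I_N + 'I_N) (triangle N (box_int k))%:C * v ^ (box_int k) = r%:C.
Proof.
move=> N0 v1; exists (N%:R^-1 * normc (\sum_(m < N) v ^+ m) ^+ 2).
split; first by rewrite mulr_ge0 ?invr_ge0// sqr_ge0.
have NR : N%:R != 0 :> R by rewrite pnatr_eq0 -lt0n.
have tr (m : nat) : (m <= N)%N -> Num.max 0 (1 - m%:R / N%:R) = N%:R^-1 * (N - m)%:R :> R.
  move=> mN; have -> : 1 - m%:R / N%:R = N%:R^-1 * (N - m)%:R :> R.
    by rewrite natrB//; field.
  by apply/max_idPr; rewrite mulr_ge0// invr_ge0.
have vV : v^-1 = v^*.
  have v0 : v != 0 by apply: contra_eq_neq v1 => ->; rewrite normc0 eq_sym oner_eq0.
  by apply: (mulfI v0); rewrite mulcJ_of_normc1// mulfV.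
have := fejer_kernel1 N v1; move: (normc _ ^+ 2) => n2 n2E.
rewrite big_sumType/= rmorphM/= -n2E mulrDr !mulr_sumr; congr (_ + _).
  apply: eq_bigr => m _; rewrite /triangle/= tr ?(ltnW (ltn_ord m))//.
  by rewrite rmorphM rmorph_nat mulrA.
apply: eq_bigr => m _; rewrite NegzE /triangle abszN absz_nat tr//.
by rewrite rmorphM rmorph_nat mulrA -exprz_inv vV.
Qed.

Lemma triangle01 N k : 0 <= triangle N k <= 1.
Proof.
rewrite /triangle le_max lexx/= ge_max ler01/= gerBl.
by rewrite divr_ge0.
Qed.

Variable n : nat.
Local Notation index := {ffun 'I_n -> int}.

Definition box N : seq index :=
  [seq [ffun i => box_int (k i)] | k : {ffun 'I_n -> 'I_N + 'I_N}].

Definition box_weight N (a : index) : R := \prod_(i < n) triangle N (a i).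

Lemma mem_box N (a : index) : (forall i, (`|a i| < N)%N) -> a \in box N.
Proof.
case: N => [|N] aN.
  (* For [N = 0] the hypothesis can hold only when there are no coordinates, so the choice function
     is built from the contradiction. *)
  apply/mapP; exists [ffun i => False_rect _ (Bool.diff_false_true (aN i))].
    by rewrite mem_enum.
  by apply/ffunP => i; have := aN i.
apply/mapP; exists [ffun i => match a i with Posz m => inl (inord m)
  | Negz m => inr (inord m) end]; first by rewrite mem_enum.
apply/ffunP => i; rewrite !ffunE; have := aN i.
by case: (a i) => m /= mN; rewrite inordK// ltnW.
Qed.

(** The kernel is a product over the coordinates of one-variable Fejer kernels at [x_i * conj y_i].
    It is thus nonnegative, and expanding the product of sums yields the sum over the box. *)
Lemma box_fejer_weights N : (0 < N)%N ->
  fejer_weights (fun a => monomial a : torus R n -> R[i]) (box N) (box_weight N).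
Proof.
move=> N0; split.
- rewrite map_inj_uniq ?enum_uniq// => k k' /ffunP kk'.
  by apply/ffunP => i; have := kk' i; rewrite !ffunE => /box_int_inj.
- by apply: mem_box => i; rewrite ffunE.
- move=> a; rewrite /box_weight; elim/big_ind: _ => [|x y /andP[x0 x1] /andP[y0 y1]|i _].
  + by rewrite ler01 lexx.
  + by rewrite mulr_ge0// mulr_ile1.
  + exact: triangle01.
- rewrite /box_weight big1// => i _; rewrite ffunE /triangle absz0 mul0r subr0.
  by apply/max_idPr.
- move=> x y.
  have v1 i : normc (val (tnth x i) * (val (tnth y i))^*) = 1.
    by rewrite normcM normc_conj !normc_circle mulr1.
  have [r rP] := choice (fun i => fejer_kernel_ge0 N0 (v1 i)).
  exists (\prod_(i < n) r i); split.
    by apply: prodr_ge0 => i _; case: (rP i).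
  rewrite rmorph_prod/=.
  rewrite [RHS](eq_bigr _ (fun i _ => esym (rP i).2)).
  rewrite bigA_distr_bigA big_map big_enum/=; apply: eq_bigr => k _.
  rewrite /box_weight /monomial rmorph_prod rmorph_prod -!big_split/=.
  apply: eq_bigr => i _; rewrite ffunE; congr (_ * _).
  rewrite expfzMl; congr (_ * _).
  case: (box_int _) => m; first exact: rmorphXn.
  by rewrite NegzE -!exprz_inv -conjc_inv; exact: rmorphXn.
Qed.

(** Weierstrass' product inequality, which turns small defects of the coordinate weights into a
    small defect of their product. *)
Lemma prod_onem_ge (I : Type) (s : seq I) (x : I -> R) :
  (forall i, 0 <= x i <= 1) ->
  1 - \sum_(i <- s) (1 - x i) <= \prod_(i <- s) x i.
Proof.
move=> x01; elim: s => [|i s IH]; first by rewrite !big_nil subr0.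
rewrite !big_cons; have /andP[x0 x1] := x01 i.
have s0 : 0 <= \sum_(j <- s) (1 - x j).
  by apply: sumr_ge0 => j _; rewrite subr_ge0; case/andP: (x01 j).
have := ler_wpM2l x0 IH.
have : 0 <= (1 - x i) * \sum_(j <- s) (1 - x j) by rewrite mulr_ge0// subr_ge0.
lra.
Qed.

Lemma fejer_approx_weights (A : seq index) (eps : R) : 0 < eps ->
  exists S w, [/\ fejer_weights (fun a => monomial a : torus R n -> R[i]) S w,
    {subset A <= S} & forall a, a \in A -> 1 - eps <= w a].
Proof.
move=> eps0.
pose C := (\sum_(a <- A) \sum_(i < n) `|a i|)%N.
(* [N > C] puts [A] inside the box, and [N >= C / eps] bounds the defect of the weights, at most
   [C / N], by [eps]. *)
pose N := (maxn C (Num.bound (C%:R / eps))).+1.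
have CN : (C < N)%N by rewrite ltnS leq_maxl.
have aC a : a \in A -> (\sum_(i < n) `|a i| <= C)%N.
  by move=> aA; rewrite /C (big_rem a)//= leq_addr.
exists (box N), (box_weight N); split; first exact: box_fejer_weights.
- move=> a aA; apply: mem_box => i; apply: leq_ltn_trans CN.
  apply: leq_trans (aC a aA).
  by rewrite (bigD1 i)//= leq_addr.
- move=> a aA; apply: le_trans (prod_onem_ge _ _); last by move=> i; exact: triangle01.
  rewrite lerD2l lerN2.
  apply: (@le_trans _ _ (\sum_(i < n) (`|a i|%N%:R / N%:R))).
    apply: ler_sum => i _; rewrite /triangle lerBlDr -lerBlDl le_max.
    by apply/orP; right.
  rewrite -mulr_suml ler_pdivrMr ?ltr0n// -natr_sum.
  apply: (@le_trans _ _ C%:R); first by rewrite ler_nat; exact: aC.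
  rewrite mulrC -ler_pdivrMr//.
  apply/ltW/(lt_le_trans (archi_boundP _)); first by rewrite divr_ge0// ltW.
  by rewrite ler_nat /N (leq_trans (leq_maxr C _)).
Qed.

End fejer_kernel.

(** * The critical exponent *)

Section norms.
Variables (R : realType) (n : nat).
Local Notation mu := (torus_measure R n).
Implicit Types (f g : torus R n -> R[i]).

Lemma measurable_normc f : measurable_complex f ->
  measurable_fun setT (fun z => normc (f z)).
Proof.
move=> [mr mi].
have -> : (fun x => normc (f x)) = Num.sqrt \o
    (fun x => complex.Re (f x) ^+ 2 + complex.Im (f x) ^+ 2).
  by apply/funext => x /=; case: (f x).
apply: measurableT_comp; first by apply: continuous_measurable_fun; exact: sqrt_continuous.
by apply: measurable_funD; exact: measurable_funX.
Qed.

Lemma torus_normE (p : R) f :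
  torus_norm p%:E f = ((\int[mu]_z (normc (f z) `^ p)%:E) `^ p^-1)%E.
Proof.
rewrite /torus_norm Lnorm.unlock; congr (poweR _ _); apply: eq_integral => z _.
by rewrite /= ger0_norm ?normc_ge0.
Qed.

Lemma torus_normyE f : torus_norm +oo f = ess_sup mu (fun z => (normc (f z))%:E).
Proof.
rewrite /torus_norm unlock /= probability_setT lte01; congr ess_sup.
by apply/funext => z /=; rewrite ger0_norm ?normc_ge0.
Qed.

(** Monotone convergence along the truncations at the natural numbers; finiteness of the norm of [g]
    is part of the conclusion. *)
Lemma torus_norm_le1 (p : R) g : 0 < p -> measurable_complex g ->
  (forall M, 0 <= M -> Er mu (fun z => Num.min (normc (g z)) M `^ p) <= 1) ->
  (torus_norm p%:E g <= 1)%E.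
Proof.
move=> p0 mg gM; rewrite torus_normE -(poweR1r p^-1).
apply: gt0_ler_poweR; rewrite ?invr_ge0 ?(ltW p0)// ?in_itv/= ?leey ?andbT ?lee01//.
  by apply: integral_ge0 => z _; rewrite lee_fin powR_ge0.
have bM (k : nat) : bfun (fun z => Num.min (normc (g z)) k%:R `^ p).
  apply: bfun_powR; [exact: ltW|by move=> z; rewrite le_min normc_ge0 ler0n|].
  split; first by apply: measurable_minr => //; exact: measurable_normc.
  by exists k%:R => z; rewrite ger0_norm ?le_min ?normc_ge0 ?ler0n// ge_min lexx orbT.
have : (\int[mu]_z (Num.min (normc (g z)) k%:R `^ p)%:E @[k --> \oo] -->
    \int[mu]_z (normc (g z) `^ p)%:E)%E.
  have -> : (\int[mu]_z (normc (g z) `^ p)%:E)%E = (\int[mu]_z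
      limn (fun k => (Num.min (normc (g z)) k%:R `^ p)%:E))%E.
    apply: eq_integral => z _; apply/esym/cvg_lim => //.
    apply: cvg_near_cst; near=> k; congr (_ `^ p)%:E; apply/min_idPl.
    by near: k; exact: nbhs_infty_ger.
  apply: cvg_monotone_convergence => //.
  - by move=> k; apply/measurable_EFinP; case: (bM k).
  - by move=> k z _; rewrite lee_fin powR_ge0.
  - move=> z _ k m km; rewrite lee_fin ge0_ler_powR ?(ltW p0) ?nnegrE ?le_min ?normc_ge0 ?ler0n//.
    by rewrite ge_min lexx/= ge_min ler_nat km orbT.
move=> cvg_int; rewrite -(cvg_lim _ cvg_int)//; apply: lime_le.
  apply: ereal_nondecreasing_is_cvgn => k m km.
  apply: ge0_le_integral => //.
  - by move=> z _; rewrite lee_fin powR_ge0.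
  - by apply/measurable_EFinP; case: (bM k).
  - by apply/measurable_EFinP; case: (bM m).
  - move=> z _; rewrite lee_fin ge0_ler_powR ?(ltW p0) ?nnegrE ?le_min ?normc_ge0 ?ler0n//.
    by rewrite ge_min lexx/= ge_min ler_nat km orbT.
by near=> k; rewrite -EFin_Er// lee_fin gM.
Unshelve. all: by end_near. Qed.

Lemma Er_min_le_torus_norm2 f (M eps : R) : 0 <= M -> 0 < eps -> measurable_complex f ->
  (torus_norm 2%:E f < eps%:E)%E ->
  Er mu (fun z => Num.min (normc (f z)) M ^+ 2) <= eps ^+ 2.
Proof.
move=> M0 eps0 mf; rewrite torus_normE => lt_eps.
have int_ge0 : (0 <= \int[mu]_z (normc (f z) `^ 2)%:E)%E.
  by apply: integral_ge0 => z _; rewrite lee_fin powR_ge0.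
have int_le : (\int[mu]_z (normc (f z) `^ 2)%:E <= (eps ^+ 2)%:E)%E.
  set X := integral _ _ _ in int_ge0 lt_eps *.
  have -> : X = ((X `^ 2^-1) `^ 2)%E by rewrite -poweRrM mulVf// poweRe1.
  rewrite -powR_mulrn ?(ltW eps0)// -poweR_EFin.
  apply: gt0_ler_poweR => //; rewrite ?in_itv/= ?leey ?andbT ?poweR_ge0 ?lee_fin ?(ltW eps0)//.
  exact: ltW.
have bM : bfun (fun z => Num.min (normc (f z)) M ^+ 2).
  apply: bfunX; split; first by apply: measurable_minr => //; exact: measurable_normc.
  by exists M => z; rewrite ger0_norm ?le_min ?normc_ge0// ge_min lexx orbT.
rewrite -lee_fin EFin_Er//; apply: le_trans int_le.
apply: ge0_le_integral => //.
- by move=> z _; rewrite lee_fin sqr_ge0.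
- by apply/measurable_EFinP; case: bM.
- apply/measurable_EFinP.
  exact: (measurableT_comp (measurable_powR 2) (measurable_normc mf)).
- move=> z _; rewrite lee_fin powR_mulrn ?normc_ge0//.
  by rewrite ler_sqr ?nnegrE ?le_min ?normc_ge0// ge_min lexx.
Qed.

Lemma fourier_coefE f : fourier_coef f = fhat mu (fun a => monomial a) f.
Proof. by []. Qed.

Lemma measurable_complexM f g : measurable_complex f -> measurable_complex g ->
  measurable_complex (fun z => f z * g z).
Proof.
move=> [rf mf] [rg mg]; split; under eq_fun do rewrite cReImE.
  by apply: measurable_funB; exact: measurable_funM.
by apply: measurable_funD; exact: measurable_funM.
Qed.

Lemma measurable_complexB f g : measurable_complex f -> measurable_complex g ->
  measurable_complex (fun z => f z - g z).
Proof.
by move=> [rf mf] [rg mg]; split; under eq_fun do rewrite !cReImE;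
  exact: measurable_funB.
Qed.

Lemma measurable_complex_bcfun f : bcfun f -> measurable_complex f.
Proof. by move=> [[? _] [? _]]. Qed.

Lemma Rintegral_ae_eq (f g : torus R n -> R) : measurable_fun setT f ->
  measurable_fun setT g -> {ae mu, forall z, f z = g z} ->
  \int[mu]_z f z = \int[mu]_z g z.
Proof.
move=> mf mg fg; congr fine; apply: ae_eq_integral => //.
- exact/measurable_EFinP.
- exact/measurable_EFinP.
- by apply: filterS fg => z /= ->.
Qed.

(** Setting [f] to 0 where its modulus exceeds 1 alters it on a null set, which the Fourier
    coefficients do not see. *)
Lemma truncate_le1 f : measurable_complex f -> (torus_norm +oo f <= 1)%E ->
  exists f1, [/\ bcfun f1, forall z, normc (f1 z) <= 1 & fourier_coef f1 = fourier_coef f].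
Proof.
move=> mf; rewrite torus_normyE => /ess_supP f1ae.
pose D := [set z | normc (f z) <= 1].
have mD : measurable D.
  have -> : D = setT `&` (fun z => normc (f z)) @^-1` [set` `]-oo, 1]].
    by rewrite setTI; apply/seteqP; split => z /=; rewrite in_itv.
  exact: (measurable_normc mf).
pose f1 z := if normc (f z) <= 1 then f z else 0.
have f1P z : normc (f1 z) <= 1.
  by rewrite /f1; case: ifP => //; rewrite normc0.
have mif (h : torus R n -> R) : measurable_fun setT h ->
    measurable_fun setT (fun z => if normc (f z) <= 1 then h z else 0).
  move=> mh; have -> : (fun z => if normc (f z) <= 1 then h z else 0) =
      (fun z => h z * \1_D z).
    apply/funext => z; rewrite indicE.
    have -> : (z \in D) = (normc (f z) <= 1) by apply/idP/idP; rewrite inE.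
    by case: ifP; rewrite ?mulr1 ?mulr0.
  by apply: measurable_funM => //; exact: measurable_indic.
have [mr mi] := mf.
have mf1 : measurable_complex f1.
  split.
    rewrite (_ : (fun z => _) = fun z => if normc (f z) <= 1 then complex.Re (f z) else 0).
      exact: mif.
    by apply/funext => z; rewrite /f1; case: ifP.
  rewrite (_ : (fun z => _) = fun z => if normc (f z) <= 1 then complex.Im (f z) else 0).
    exact: mif.
  by apply/funext => z; rewrite /f1; case: ifP.
exists f1; split => //.
  by case: mf1 => ? ?; apply: bcfunE => //; exists 1.
have eqae : {ae mu, forall z, f1 z = f z}.
  by apply: filterS f1ae => z /=; rewrite lee_fin /f1 => ->.
apply/funext => a; apply: complexP => /=; apply: Rintegral_ae_eq.
- by case: (measurable_complexM mf1 (measurable_complex_bcfun (bcfunJ (bcfun_monomial R a)))).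
- by case: (measurable_complexM mf (measurable_complex_bcfun (bcfunJ (bcfun_monomial R a)))).
- by apply: filterS eqae => z /= ->.
- by case: (measurable_complexM mf1 (measurable_complex_bcfun (bcfunJ (bcfun_monomial R a)))).
- by case: (measurable_complexM mf (measurable_complex_bcfun (bcfunJ (bcfun_monomial R a)))).
- by apply: filterS eqae => z /= ->.
Qed.

(** The projections are composed along a natural number index, so the degree must exist for every
    [k]; beyond the last coordinate it is 0. *)
Definition coord_deg (k : nat) (a : {ffun 'I_n -> int}) : int :=
  if insub k is Some i then a i else 0.

Lemma coord_degD k a b : coord_deg k (a + b) = coord_deg k a + coord_deg k b.
Proof. by rewrite /coord_deg; case: insub => [i|]; rewrite ?ffunE ?addr0. Qed.

Lemma nneg_up_to_coord a : nneg_up_to coord_deg n a = [forall i, 0 <= a i].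
Proof.
by apply: eq_forallb => i; rewrite /coord_deg insubT//= => ?; congr (0 <= a _); exact/val_inj.
Qed.

End norms.

(** The filter [totally] supplies a finite set of indices beyond which every partial sum is
    [L^2]-close to [g]. [riesz_approx] may be asked to include that set, so the weighted chain is
    compared with a good partial sum. *)
Lemma riesz_projection_norm_le1 (R : realType) n (f g : torus R n.+1 -> R[i]) :
  measurable_complex f -> (torus_norm +oo f <= 1)%E -> is_riesz_projection f g ->
  (torus_norm (critical_pow R n.+1)%:E g <= 1)%E.
Proof.
move=> mf f_le1 [mg cvg_g].
have [f1 [bf1 f11 fc]] := truncate_le1 mf f_le1.
have p0 : 0 < critical_pow R n.+1.
  by rewrite divr_gt0// subr_gt0 exprn_ilt1// invf_lt1// ltr1n.
apply: torus_norm_le1 => // M M0.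
have [mgr mgi] := mg.
apply: (riesz_limit_critical (@bcfun_monomial R n.+1) (@monomialD R n.+1)
  (@monomialN R n.+1) (@monomial0 R n.+1) _ (@coord_degD n.+1)
  (@fejer_approx_weights R n.+1) bf1 f11 mgr mgi M0).
  by move=> a a0; rewrite Ec_monomial (negbTE a0).
move=> eps eps0.
have nb : nbhs 0%E [set x : \bar R | (x < eps%:E)%E].
  by apply: open_nbhs_nbhs; split; [exact: open_ereal_lt_ereal|rewrite /= lte_fin].
have [A0 _ A0P] := cvg_g _ nb.
exists (enum_fset A0) => A uA A0A.
pose B := [fset x in A]%fset.
have A0B : (A0 `<=` B)%fset.
  by apply/fsubsetP => x xA0; rewrite inE; exact: A0A.
have := A0P B A0B => /= ltB.
have partE z : riesz_partial (torus_measure R n.+1) (fun a => monomial a) (@coord_deg n.+1) f1 n.+1 A z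
    = riesz_partial_sum f B z.
  rewrite /riesz_partial /riesz_partial_sum.
  under eq_bigl do rewrite nneg_up_to_coord.
  rewrite -fourier_coefE fc; apply: perm_big; apply: uniq_perm => //.
    exact: fset_uniq.
  by move=> x; rewrite inE.
have bpart : bcfun (riesz_partial (torus_measure R n.+1) (fun a => monomial a)
    (@coord_deg n.+1) f1 n.+1 A).
  rewrite /riesz_partial; under eq_fun do rewrite -big_filter.
  by apply: bcfun_esum; exact: bcfun_monomial.
apply: Er_min_le_torus_norm2 => //.
  exact: measurable_complexB mg (measurable_complex_bcfun bpart).
by under eq_fun do rewrite partE.
Qed.

(** * Test functions with explicit coefficients *)

Section trigonometric_polynomials.
Variables (R : realType) (n : nat).
Local Notation index := {ffun 'I_n -> int}.
Local Notation mu := (torus_measure R n).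
Implicit Types (s : seq (R[i] * index)).

Definition nneg_index (a : index) := [forall i, 0 <= a i].

(** Unlike [tpoly], this keeps the list of coefficients as data, so that the projection of an
    explicit polynomial is computed by filtering; indices may repeat. *)
Definition trigpoly s (z : torus R n) : R[i] :=
  \sum_(p <- s) p.1 * monomial p.2 z.

Lemma bcfun_trigpoly s : bcfun (trigpoly s).
Proof.
by apply: bcfun_sum => p; apply: bcfunM; [exact: bcfun_cst|exact: bcfun_monomial].
Qed.

Lemma fourier_coef_trigpoly s a :
  fourier_coef (trigpoly s) a = \sum_(p <- s) p.1 * (p.2 == a)%:R.
Proof.
rewrite fourier_coefE /fhat /trigpoly; under eq_fun do rewrite mulr_suml.
have bm (b c : index) : bcfun (fun z : torus R n => monomial b z * (monomial c z)^*).
  by apply: bcfunM; [exact: bcfun_monomial|apply: bcfunJ; exact: bcfun_monomial].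
rewrite Ec_sum => [|p]; last first.
  under eq_fun do rewrite -mulrA.
  by apply: bcfunM => //; exact: bcfun_cst.
apply: eq_bigr => p _; under eq_fun do rewrite -mulrA.
rewrite EcZ//; congr (_ * _).
under eq_fun do rewrite -monomialN -monomialD.
by rewrite Ec_monomial subr_eq0.
Qed.

(** The partial sums are constant as soon as the finite set contains all indices of [s], so the
    limit is attained. *)
Lemma is_riesz_projection_trigpoly s : is_riesz_projection (trigpoly s)
  (trigpoly [seq p <- s | nneg_index p.2]).
Proof.
split; first exact: measurable_complex_bcfun (bcfun_trigpoly _).
apply: (@cvg_near_cst _ _ 0%E _ totally).
  by apply: filter_filter; exact: totally_filter.
exists [fset p.2 | p in s]%fset => // A /= /fsubsetP sA.
have partE z : riesz_partial_sum (trigpoly s) A z =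
    trigpoly [seq p <- s | nneg_index p.2] z.
  rewrite /riesz_partial_sum /trigpoly big_filter /nneg_index.
  rewrite [LHS](eq_bigr (fun a => \sum_(p <- s) p.1 * (p.2 == a)%:R * monomial a z));
    last by move=> a _; rewrite -mulr_suml -fourier_coef_trigpoly.
  rewrite exchange_big/= [RHS]big_mkcond/=.
  apply: eq_big_seq => p ps.
  have pA : p.2 \in enum_fset A by apply: sA; apply/imfsetP; exists p.
  rewrite big_mkcond/= (big_rem _ pA)/= big1_seq => [|a /andP[_]].
    by case: ifP; rewrite ?addr0// eqxx mulr1.
  rewrite mem_rem_uniq ?fset_uniq// inE => /andP[/negPf ap _].
  by case: ifP => // _; rewrite eq_sym ap mulr0 mul0r.
rewrite torus_normE (eq_integral (cst 0%E)).
  by rewrite integral0 poweR0r// invr_neq0.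
by move=> z _; rewrite partE subrr normc0 powR0.
Qed.

Lemma torus_normy_le1 (f : torus R n -> R[i]) : (forall z, normc (f z) <= 1) ->
  (torus_norm +oo f <= 1)%E.
Proof.
move=> f1; rewrite torus_normyE; apply/ess_supP.
by apply: nearW => z; rewrite lee_fin.
Qed.

Lemma torus_norm_trigpoly_le_riesz_norm s (p : R) : (forall z, normc (trigpoly s z) <= 1) ->
  (torus_norm p%:E (trigpoly [seq p <- s | nneg_index p.2]) <= riesz_norm n p)%E.
Proof.
move=> s1; apply: ereal_sup_ubound; exists (trigpoly s), (trigpoly [seq p <- s | nneg_index p.2]).
split => //.
- exact: measurable_complex_bcfun (bcfun_trigpoly _).
- exact: torus_normy_le1.
- exact: is_riesz_projection_trigpoly.
Qed.

Lemma riesz_norm_ge1 (p : R) : (1 <= riesz_norm n p)%E.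
Proof.
have t1 s z : s = [:: (1, 0 : index)] -> trigpoly s z = 1.
  by move=> ->; rewrite /trigpoly big_seq1 monomial0 mulr1.
apply: le_trans (torus_norm_trigpoly_le_riesz_norm (s := [:: (1, 0)]) p _); last first.
  by move=> z; rewrite t1// normc1.
rewrite torus_normE (eq_integral (cst 1%E)).
  by rewrite integral_cst//= mul1e probability_setT poweR1r.
move=> z _; rewrite t1 ?normc1 ?powR1//=.
have -> // : nneg_index 0 by apply/forallP => i; rewrite ffunE.
Qed.

End trigonometric_polynomials.

Lemma le_critical_exponent (R : realType) n :
  ((2 + 2 / (2 ^+ n.+1 - 1))%:E <= critical_exponent R n.+1)%E.
Proof.
have p2n : 1 < 2 ^+ n.+1 :> R by rewrite exprn_egt1// ltr1n.
have -> : 2 + 2 / (2 ^+ n.+1 - 1) = critical_pow R n.+1.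
  rewrite /critical_pow exprVn; move: p2n; set t := 2 ^+ _ => t1.
  by field; rewrite ?subr_eq0 ?(gt_eqF t1) ?(gt_eqF (lt_trans ltr01 t1)).
apply: ereal_sup_ubound; exists (critical_pow R n.+1) => //; split.
  rewrite /critical_pow ler_pdivlMr ?subr_gt0 ?exprn_ilt1 ?invf_lt1 ?ltr1n//.
  by rewrite ler_piMr// gerBl exprn_ge0.
apply/eqP; rewrite eq_le riesz_norm_ge1 andbT.
apply: ge_ereal_sup => _ [f [g [mf f1 fg ->]]].
exact: riesz_projection_norm_le1 fg.
Qed.

(** * A function in two variables whose projection violates the bound below 4 *)

(** Over an abstract field, with [v^-1] in place of the conjugate and [i] a plain symbol, the
    expansion is a rational identity within reach of [field]. For instance [49/64 = 1 - 1/4 + 1/64]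
    collects the constant terms of the powers of [(v + v^-1) / 2]. *)
Lemma taylor4_identity (F : numFieldType) (c i v : F) : v != 0 ->
  49 / 64 * (c * v ^ 0) + (i * (7 / 16) * (c * v ^ 1) +
  (i * (7 / 16) * (c * v ^ (-1)) + (- (11 / 96) * (c * v ^ 2) +
  (- (11 / 96) * (c * v ^ (-2)) + (- (i / 48) * (c * v ^ 3) +
  (- (i / 48) * (c * v ^ (-3)) + (384^-1 * (c * v ^ 4) +
  (384^-1 * (c * v ^ (-4)) + 0)))))))) =
  c * (1 - ((v + v^-1) / 2) ^+ 2 / 2 + ((v + v^-1) / 2) ^+ 4 / 24 +
       i * ((v + v^-1) / 2 - ((v + v^-1) / 2) ^+ 3 / 6)).
Proof.
move=> v0.
have -> : v ^ (-2) = v^-1 ^+ 2 by rewrite -exprz_inv.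
have -> : v ^ (-3) = v^-1 ^+ 3 by rewrite -exprz_inv.
have -> : v ^ (-4) = v^-1 ^+ 4 by rewrite -exprz_inv.
rewrite exprN1 expr0z expr1z -!exprnP.
by field.
Qed.

Lemma taylor4_proj_identity (F : numFieldType) (c i v : F) :
  49 / 64 * (c * v ^ 0) + (i * (7 / 16) * (c * v ^ 1) +
  (i * (7 / 16) * (c * v ^ (-1)) + 0)) =
  c * (49 / 64 + i * (7 / 8 * ((v + v^-1) / 2))).
Proof. by rewrite exprN1 expr0z expr1z; move: (v^-1) => w; field. Qed.

Section four_is_not_attained.
Variables (R : realType) (m : nat).
Local Notation mu := (torus_measure R m.+2).
Local Notation index := {ffun 'I_m.+2 -> int}.
Local Notation T := (torus R m.+2).
Implicit Types (z : T) (k l : int).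

Let i1 : 'I_m.+2 := lift ord0 ord0.

Definition plane_index k l : index :=
  [ffun i => if i == ord0 then k else if i == i1 then l else 0].

Lemma monomial_plane k l z :
  monomial (plane_index k l) z = val (tnth z ord0) ^ k * val (tnth z i1) ^ l.
Proof.
rewrite /monomial !big_ord_recl big1 ?mulr1 => [|i _].
  by rewrite !ffunE.
by rewrite ffunE expr0z.
Qed.

Lemma plane_index_eq0 k l : (plane_index k l == 0) = (k == 0) && (l == 0).
Proof.
apply/eqP/andP => [/ffunP h|[/eqP -> /eqP ->]].
  by split; [have := h ord0|have := h i1]; rewrite !ffunE => /= ->.
by apply/ffunP => i; rewrite !ffunE; do 2?case: ifP.
Qed.

Lemma nneg_plane_index k l : nneg_index (plane_index k l) = (0 <= k) && (0 <= l).
Proof.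
apply/forallP/andP => [h|[k0 l0] i].
  by split; [have := h ord0|have := h i1]; rewrite ffunE.
by rewrite ffunE; do 2?case: ifP.
Qed.

Let v z : R[i] := val (tnth z ord0) * (val (tnth z i1))^*.
Let x z : R := complex.Re (v z).

Let v_norm z : normc (v z) = 1.
Proof. by rewrite normcM normc_conj !normc_circle mulr1. Qed.

Let v_neq0 z : v z != 0.
Proof.
by apply: contra_eq_neq (v_norm z) => ->; rewrite normc0 eq_sym oner_eq0.
Qed.

Let vV z : (v z)^-1 = (v z)^*.
Proof. by apply: (mulfI (v_neq0 z)); rewrite mulcJ_of_normc1// mulfV. Qed.

Let xE z : (x z)%:C = (v z + (v z)^-1) / 2.
Proof. by rewrite vV; apply: complexP; rewrite /x; case: (v z) => a b /=; field. Qed.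

(** The factor [z1 z2] shifts [v ^ k] to the index [(1 + k, 1 - k)], which is nonnegative exactly
    for [k] in [{-1, 0, 1}]: the projection cuts the powers of [v] on both sides. *)
Let monomial_shift k z :
  monomial (plane_index (1 + k) (1 - k)) z =
  val (tnth z ord0) * val (tnth z i1) * v z ^ k.
Proof.
rewrite monomial_plane /v -invc_circle expfzDr ?val_neq0// expfzDr ?val_neq0//.
by rewrite expfzMl -exprz_inv !expr1z mulrACA.
Qed.

Let cartesian (a b : R) : a +i* b = a%:C + 'i%C * b%:C.
Proof. by apply: complexP; rewrite !cReImE/=; ring. Qed.

Let ratC (k l : nat) : (k%:R / l%:R : R)%:C = k%:R / l%:R :> R[i].
Proof. by rewrite fmorph_div/= !rmorph_nat. Qed.

(* The Taylor polynomial of degree 4 of [exp (i x)] has modulus at most 1 for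
   [x ^ 2 <= 8]; expanded in powers of [v], [x = (v + v^-1) / 2]. *)
Definition taylor4 : seq (R[i] * index) :=
  [:: (49 / 64, plane_index (1 + 0) (1 - 0));
      ('i%C * (7 / 16), plane_index (1 + 1) (1 - 1));
      ('i%C * (7 / 16), plane_index (1 + -1) (1 - -1));
      (- (11 / 96), plane_index (1 + 2) (1 - 2));
      (- (11 / 96), plane_index (1 + -2) (1 - -2));
      (- ('i%C / 48), plane_index (1 + 3) (1 - 3));
      (- ('i%C / 48), plane_index (1 + -3) (1 - -3));
      (384^-1, plane_index (1 + 4) (1 - 4));
      (384^-1, plane_index (1 + -4) (1 - -4))].

Let taylor4E z : trigpoly taylor4 z = val (tnth z ord0) * val (tnth z i1) *
  ((1 - x z ^+ 2 / 2 + x z ^+ 4 / 24) +i* (x z - x z ^+ 3 / 6)).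
Proof.
have divC (a : R) (k l : nat) : (a ^+ k / l%:R)%:C = a%:C ^+ k / l%:R.
  by rewrite fmorph_div/= rmorphXn rmorph_nat.
have -> : (1 - x z ^+ 2 / 2 + x z ^+ 4 / 24) +i* (x z - x z ^+ 3 / 6) =
   1 - (x z)%:C ^+ 2 / 2 + (x z)%:C ^+ 4 / 24 +
   'i%C * ((x z)%:C - (x z)%:C ^+ 3 / 6).
  by rewrite -!divC cartesian rmorphD rmorphB (rmorphB _ (x z)).
rewrite /trigpoly /taylor4 !big_cons big_nil /= !monomial_shift xE.
exact: taylor4_identity (v_neq0 z).
Qed.

Let x_le1 z : `|x z| <= 1.
Proof. by rewrite -(v_norm z); exact: ler_normRe_normc. Qed.

Let taylor4_le1 z : normc (trigpoly taylor4 z) <= 1.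
Proof.
rewrite taylor4E !normcM !normc_circle !mul1r.
rewrite -ler_sqr ?nnegrE ?normc_ge0// sqr_normc2/= expr1n.
have : x z ^+ 2 <= 1 by rewrite -(real_normK (num_real (x z))) exprn_ile1 ?x_le1.
have := sqr_ge0 (x z); have -> : x z ^+ 4 = (x z ^+ 2) ^+ 2 by rewrite -exprM.
have -> : (x z - x z ^+ 3 / 6) ^+ 2 = x z ^+ 2 * (1 - x z ^+ 2 / 6) ^+ 2 by ring.
move: (x z ^+ 2) => y y0 y1.
have -> : (1 - y / 2 + y ^+ 2 / 24) ^+ 2 + y * (1 - y / 6) ^+ 2 =
  1 - y ^+ 3 * (8 - y) / 576 by field.
rewrite gerBl; apply: divr_ge0; last exact: ler0n.
by apply: mulr_ge0; [exact: exprn_ge0|lra].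
Qed.

Definition taylor4_proj : seq (R[i] * index) :=
  [seq p <- taylor4 | nneg_index p.2].

Let taylor4_projE z : trigpoly taylor4_proj z =
  val (tnth z ord0) * val (tnth z i1) * ((49 / 64) +i* (7 / 8 * x z)).
Proof.
rewrite /taylor4_proj /= !nneg_plane_index /= /trigpoly !big_cons big_nil /=.
rewrite !monomial_shift.
have mC : (7 / 8 * x z)%:C = 7 / 8 * (x z)%:C :> R[i].
  by rewrite -ratC -rmorphM.
have -> : (49 / 64) +i* (7 / 8 * x z) = 49 / 64 + 'i%C * (7 / 8 * (x z)%:C).
  by rewrite -mC -ratC; exact: cartesian.
rewrite xE.
exact: taylor4_proj_identity.
Qed.

Let normc_taylor4_proj z :
  normc (trigpoly taylor4_proj z) ^+ 2 = (49 / 64) ^+ 2 + (7 / 8) ^+ 2 * x z ^+ 2.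
Proof.
by rewrite taylor4_projE !normcM !normc_circle !mul1r sqr_normc2/=; field.
Qed.

Let a2 : R := (49 / 64) ^+ 2.
Let b2 : R := (7 / 8) ^+ 2.

(** Here [x] is the cosine of the argument of [v]. Its square and fourth power are expressed by the
    real parts [P 2] and [P 4] of [v ^ 2] and [v ^ 4], which have mean zero; this amounts to
    [E x ^ 2 = 1/2] and [E x ^ 4 = 3/8]. *)
Let Er_taylor4_proj :
  Er mu (fun z => (normc (trigpoly taylor4_proj z) ^+ 2) ^+ 2) =
  a2 ^+ 2 + a2 * b2 + 3 / 8 * b2 ^+ 2.
Proof.
pose P k z := complex.Re (monomial (plane_index k (- k)) z : R[i]).
have bP k : bfun (P k) by have [] := @bcfun_monomial R m.+2 (plane_index k (- k)).
have EP k : k != 0 -> Er mu (P k) = 0.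
  by move=> k0; rewrite /P -Re_Ec Ec_monomial plane_index_eq0 (negPf k0).
have PE k z : P k z = complex.Re (v z ^ k).
  by rewrite /P monomial_plane /v -invc_circle expfzMl exprz_inv.
have re2 (u : R[i]) : normc u = 1 -> complex.Re (u ^+ 2) = 2 * complex.Re u ^+ 2 - 1.
  move=> u1; have := sqr_normc2 u; rewrite u1 expr1n expr2 cReM; lra.
have P2 z : P 2 z = 2 * x z ^+ 2 - 1.
  by rewrite PE -exprnP re2.
have P4 z : P 4 z = 8 * x z ^+ 4 - 8 * x z ^+ 2 + 1.
  rewrite PE -exprnP (exprM _ 2 2) re2 ?re2 ?normcX ?v_norm ?expr1n// -/(x z).
  by ring.
have gE z : (normc (trigpoly taylor4_proj z) ^+ 2) ^+ 2 =
    (a2 ^+ 2 + a2 * b2 + 3 / 8 * b2 ^+ 2) +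
    ((a2 * b2 + b2 ^+ 2 / 2) * P 2 z + b2 ^+ 2 / 8 * P 4 z).
  rewrite normc_taylor4_proj P2 P4 -/a2 -/b2.
  have -> : x z ^+ 4 = (x z ^+ 2) ^+ 2 by rewrite -exprM.
  by move: a2 b2 (x z ^+ 2) => p q r; field.
have bZ (k : R) l : bfun (fun z => k * P l z).
  by apply: bfunM => //; exact: bfun_cst.
under eq_fun do rewrite gE.
rewrite ErD ?Er_cst; [|exact: bfun_cst|exact: bfunD].
by rewrite ErD// !ErZ// !EP// !mulr0 !addr0.
Qed.

(** An exponent [2 - delta] on [|g| ^ 2] is [4 - 1/50] on [|g|]. The relative loss
    [delta * 36/100 = 0.0036] is less than the excess of [E |g| ^ 4] over 1, which is about
    0.012. *)
Let delta : R := 100^-1.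

Let Er_taylor4_proj_gt1 :
  1 < Er mu (fun z => (normc (trigpoly taylor4_proj z) ^+ 2) `^ (2 - delta)).
Proof.
pose y z := normc (trigpoly taylor4_proj z) ^+ 2.
have yE z : y z = a2 + b2 * x z ^+ 2 by exact: normc_taylor4_proj.
have x2 z : 0 <= x z ^+ 2 <= 1.
  by rewrite sqr_ge0 -(real_normK (num_real (x z))) exprn_ile1 ?x_le1.
have y0 z : 0 < y z.
  rewrite yE; apply: ltr_wpDr; first by rewrite mulr_ge0 ?sqr_ge0.
  by rewrite exprn_gt0.
have y1 z : y z <= 1 + 36 / 100.
  by rewrite yE /a2 /b2; have /andP[] := x2 z; lra.
have by_ : bfun y by apply: bfunX; apply: bfun_normc; exact: bcfun_trigpoly.
(* [y ^ (- delta) >= 1 - delta * ln y >= 1 - delta * (y - 1)], and [y - 1 <= 36/100]. *)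
have low z : (1 - delta * (36 / 100)) * y z ^+ 2 <= y z `^ (2 - delta).
  rewrite powRD ?(gt_eqF (y0 z)) ?implybT// powR_mulrn ?(ltW (y0 z))//.
  rewrite mulrC ler_wpM2l ?sqr_ge0// /powR gt_eqF//.
  apply: le_trans (expR_ge1Dx _); rewrite lerD2l mulNr lerN2.
  rewrite ler_wpM2l ?invr_ge0//.
  have -> : y z = 1 + (y z - 1) by ring.
  apply: le_trans (le_ln1Dx _) _; last by have := y1 z; lra.
  by have := y0 z; lra.
have by2 : bfun (fun z => y z ^+ 2) by exact: bfunX.
have byp : bfun (fun z => y z `^ (2 - delta)).
  apply: bfun_powR => // [|z]; last exact: ltW.
  by rewrite /delta; lra.
apply: lt_le_trans (Er_le mu _ byp low); last first.
  by apply: bfunM => //; exact: bfun_cst.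
rewrite ErZ// Er_taylor4_proj /a2 /b2 /delta; lra.
Qed.

(** Larger exponents follow from [4 - 1/50] by Bernoulli's inequality [Y ^ s >= 1 + s (Y - 1)],
    whose mean exceeds 1 because [E Y > 1]. *)
Lemma riesz_norm_gt1 (p : R) : 4 - 50^-1 <= p -> (1 < riesz_norm m.+2 p)%E.
Proof.
move=> p4; have p0 : 0 < p by lra.
apply: lt_le_trans (torus_norm_trigpoly_le_riesz_norm p taylor4_le1).
rewrite torus_normE -/taylor4_proj -[ltLHS](poweR1r p^-1).
pose s := p / (4 - 50^-1).
have s1 : 1 <= s by rewrite ler_pdivlMr ?mul1r//; lra.
pose Y z := (normc (trigpoly taylor4_proj z) ^+ 2) `^ (2 - delta).
have Y0 z : 0 <= Y z by exact: powR_ge0.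
have bn : bfun (fun z => normc (trigpoly taylor4_proj z)).
  by apply: bfun_normc; exact: bcfun_trigpoly.
have bY : bfun Y.
  apply: bfun_powR => [|z|]; [by rewrite /delta; lra|exact: sqr_ge0|exact: bfunX].
have bnp : bfun (fun z => normc (trigpoly taylor4_proj z) `^ p).
  by apply: bfun_powR => [|z|//]; [exact: ltW|exact: normc_ge0].
have low z : 1 + s * (Y z - 1) <= normc (trigpoly taylor4_proj z) `^ p.
  have -> : normc (trigpoly taylor4_proj z) `^ p = Y z `^ s.
    rewrite /Y -powR_mulrn ?normc_ge0// -!powRrM; congr (_ `^ _).
    by rewrite /s /delta; field.
  (* Bernoulli's inequality is Young's with second factor 1; [s = 1] is set apart because the
     conjugate exponent [s / (s - 1)] is then infinite. *)
  have [s_eq1|s_neq1] := eqVneq s 1.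
    by rewrite s_eq1 powRr1// mul1r; lra.
  have s_gt1 : 1 < s by rewrite lt_neqAle eq_sym s_neq1.
  have sm1 : 0 < s - 1 by rewrite subr_gt0.
  have s0 : 0 < s by exact: lt_trans s_gt1.
  have sV : s^-1 + (s / (s - 1))^-1 = 1 by field; rewrite ?gt_eqF.
  have := conjugate_powR (Y0 z) ler01 s0 (divr_gt0 s0 sm1) sV.
  rewrite powR1 mulr1 div1r (invf_div s (s - 1)) => young.
  have : s * Y z <= s * (Y z `^ s / s + (s - 1) / s) by rewrite ler_pM2l.
  have -> : s * (Y z `^ s / s + (s - 1) / s) = Y z `^ s + (s - 1).
    by field; rewrite gt_eqF.
  lra.
have EY : 1 < Er mu Y by exact: Er_taylor4_proj_gt1.
have E1 : 1 < Er mu (fun z => normc (trigpoly taylor4_proj z) `^ p).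
  have bYs : bfun (fun z => 1 + s * (Y z - 1)).
    apply: bfunD; first exact: bfun_cst.
    apply: bfunM; first exact: bfun_cst.
    by apply: bfunB => //; exact: bfun_cst.
  apply: lt_le_trans (Er_le mu bYs bnp low).
  rewrite ErD ?Er_cst; [|exact: bfun_cst|].
    rewrite ErZ; last by apply: bfunB => //; exact: bfun_cst.
    rewrite ErB ?Er_cst//; last exact: bfun_cst.
    by rewrite ltrDl mulr_gt0 ?subr_gt0// (lt_le_trans ltr01).
  apply: bfunM; first exact: bfun_cst.
  by apply: bfunB => //; exact: bfun_cst.
rewrite -EFin_Er// poweR1r -(poweR1r p^-1) !poweR_EFin lte_fin.
by rewrite gt0_ltr_powR ?invr_gt0 ?nnegrE// (le_trans ler01)// ltW.
Qed.

(** A whole interval below 4 is excluded, so the supremum is at most [4 - 1/50] and the inequality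
    stays strict. *)
Lemma critical_exponent_lt4 : (critical_exponent R m.+2 < 4%:E)%E.
Proof.
apply: (@le_lt_trans _ _ (4 - 50^-1)%:E); last by rewrite lte_fin; lra.
apply: ge_ereal_sup => _ [p [_ p1] <-]; rewrite lee_fin leNgt; apply/negP => p4.
by have := riesz_norm_gt1 (ltW p4); rewrite p1 ltxx.
Qed.

End four_is_not_attained.

Theorem theorem4 (R : realType) (n : nat) (n_gt1 : (1 < n)%N) :
  ((2 + 2 / (2 ^+ n - 1))%:E <= critical_exponent R n)%E /\
  (critical_exponent R n < 4%:E)%E.
Proof.
case: n n_gt1 => [|[|m]]// _.
by split; [exact: le_critical_exponent|exact: critical_exponent_lt4].
Qed.
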